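(* Let $u$ be the exact solution of the interface problem and $\vec e=(e_{i,j})_{0\le i,j\le N}$, $e_{i,j}=u(x_i,y_j)-u_{i,j}$, the error vector of the five-point scheme, as described in the context. If $u\in W$, then $$\|\vec e\|_\infty \lesssim h\,|\ln h| .$$ Further, if in addition Assumption I holds, i.e. $\kappa^*=\frac{2\kappa^-}{\kappa^-+1}$ and $\lim_{x\to (1/2)^-}\frac{\partial^2u}{\partial y^2}(x,y)=\lim_{x\to (1/2)^+}\frac{\partial^2u}{\partial y^2}(x,y)=0$ for all $y$, then $$\|\vec e\|_\infty \lesssim h^2\,|\ln h| .$$
   Context: Interface problem. $\Omega=(0,1)\times(0,1)$, $D_1=(0,\frac12)\times(0,1)$, $D_2=(\frac12,1)\times(0,1)$, $\Gamma=\{x=\frac12\}$ is the interface. $\kappa=\kappa^-$ in $D_1$ with a constant $\kappa^-\ge 1$, and $\kappa=1$ in $D_2$. The exact solution $u$ satisfies $-\nabla\cdot(\kappa\nabla u)+u=f$ in $\Omega$ (in $D_1$ and in $D_2$), $u=0$ on $\partial\Omega$, and $[u]=[\kappa\,\partial u/\partial \vec n]=0$ on $\Gamma$, where $[\cdot]$ is the jump across $\Gamma$ and $\vec n$ is the unit normal to $\Gamma$. $W=\{w:\ w|_{\bar D_i}\in C^6(\bar D_i),\ i=1,2\}$. Grid. $N=2M+1$ with $M$ a positive integer, $h=1/N$, $x_i=ih$, $y_j=jh$ ($0\le i,j\le N$), so $\Gamma$ is the line $x=x_M+\frac h2$. $S_1^I=\{(i,j):1\le i\le M-1,1\le j\le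 N-1\}$, $S_2^I=\{(i,j):M+2\le i\le N-1,1\le j\le N-1\}$, $S_1^B=\{(M,j):1\le j\le N-1\}$, $S_2^B=\{(M+1,j):1\le j\le N-1\}$, $S_0=\{1,\dots,N-1\}^2$. Scheme. $\kappa^*$ is a fixed average of $\kappa^-$ and $1$ (e.g. arithmetic or harmonic; $1\le\kappa^*\le\kappa^-$, independent of $h$). For a grid function $v$, $$L_hv_{i,j}=a_1^{i,j}v_{i-1,j-1}+a_2^{i,j}v_{i+1,j-1}+a_3^{i,j}v_{i,j}+a_4^{i,j}v_{i-1,j+1}+a_5^{i,j}v_{i+1,j+1},$$ with: on $S_1^I$: $a_1=a_2=a_4=a_5=-\frac12\kappa^-$, $a_3=2\kappa^-+h^2$; on $S_1^B$: $a_1=a_4=-\frac12\kappa^-$, $a_2=a_5=-\frac12\kappa^*$, $a_3=\kappa^-+\kappa^*+h^2$; on $S_2^B$: $a_1=a_4=-\frac12\kappa^*$, $a_2=a_5=-\frac12$, $a_3=\kappa^*+1+h^2$; on $S_2^I$: $a_1=a_2=a_4=a_5=-\frac12$, $a_3=2+h^2$. The discrete solution $(u_{i,j})$ solves $L_hu_{i,j}=h^2f(x_i,y_j)$ for $(i,j)\in S_0$, with $u_{0,j}=u_{N,j}=u_{i,0}=u_{i,N}=0$ for $0\le i,j\le N$. $\|\cdot\|_\infty$ is the maximum norm of a vector. $A\lesssim B$ means $A\le CB$ with a constant $C>0$ independent of $h$ (it may depend on $u,\kappa^-,\kappa^*$). *)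

(* Defs.v *)
From Stdlib Require Import Reals Arith List.
From Coquelicot Require Import Coquelicot.
Open Scope R_scope.

(** * Domains *)

Definition rect (a b : R) (p : R * R) : Prop :=
  a < fst p < b /\ 0 < snd p < 1.

Definition rect_bar (a b : R) (p : R * R) : Prop :=
  a <= fst p <= b /\ 0 <= snd p <= 1.

Definition D1 : R * R -> Prop := rect 0 (1/2).
Definition D2 : R * R -> Prop := rect (1/2) 1.

Definition boundary_Omega (p : R * R) : Prop :=
  rect_bar 0 1 p /\ ~ rect 0 1 p.

(** * The space W *)

(* Continuity relative to [A]: nothing is asked of [g] outside [A]. *)
Definition continuous_on_set (A : R * R -> Prop) (g : R -> R -> R) : Prop :=
  forall x y, A (x, y) ->
    filterlim (fun p : R * R => g (fst p) (snd p))
      (within A (locally (x, y))) (locally (g x y)).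

(* [u] is of class C^k in the open rectangle, and [u] and all its partial
   derivatives of order at most [k] extend continuously to the closed one. The
   extension of [u] is [u] itself; those of the derivatives are given by [g],
   since [partial_derive] is only meaningful in the open rectangle. *)
Definition Ck_closed_rect (k : nat) (a b : R) (u : R -> R -> R) : Prop :=
  (forall x y, rect a b (x, y) -> ex_diff_n u k x y) /\
  continuous_on_set (rect_bar a b) u /\
  (forall m n : nat, (m + n <= k)%nat ->
     exists g : R -> R -> R,
       continuous_on_set (rect_bar a b) g /\
       forall x y, rect a b (x, y) -> g x y = partial_derive m n u x y).

Definition in_W (u : R -> R -> R) : Prop :=
  Ck_closed_rect 6 0 (1/2) u /\ Ck_closed_rect 6 (1/2) 1 u.

(** * The interface problem *)

(* Only the values for [x <> 1/2] are ever relevant. *)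
Definition kappa (km x : R) : R := if Rlt_dec x (1/2) then km else 1.

Definition no_jump (g : R -> R -> R) : Prop :=
  forall y, 0 < y < 1 ->
    exists l : R,
      filterlim (fun x => g x y) (at_left (1/2)) (locally l) /\
      filterlim (fun x => g x y) (at_right (1/2)) (locally l).

Definition div_kappa_grad (km : R) (u : R -> R -> R) (x y : R) : R :=
  Derive (fun s => kappa km s * Derive (fun t => u t y) s) x
  + Derive (fun s => kappa km x * Derive (fun t => u x t) s) y.

Definition exact_solution (km : R) (f u : R -> R -> R) : Prop :=
  (forall x y, D1 (x, y) \/ D2 (x, y) ->
     - div_kappa_grad km u x y + u x y = f x y) /\
  (forall x y, boundary_Omega (x, y) -> u x y = 0) /\
  no_jump u /\
  no_jump (fun x y => kappa km x * Derive (fun t => u t y) x).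

Definition assumption_I (km ks : R) (u : R -> R -> R) : Prop :=
  ks = 2 * km / (km + 1) /\
  forall y, 0 < y < 1 ->
    filterlim (fun x => partial_derive 0 2 u x y) (at_left (1/2)) (locally 0) /\
    filterlim (fun x => partial_derive 0 2 u x y) (at_right (1/2)) (locally 0).

(** * The scheme *)

Definition N (M : nat) : nat := (2 * M + 1)%nat.
Definition h (M : nat) : R := / INR (N M).
Definition node (M i : nat) : R := INR i * h M.

(* The coefficients (a1, a2, a3, a4, a5); the four cases are, in this order,
   S_1^I, S_1^B, S_2^B and S_2^I. *)
Definition stencil (km ks : R) (M i : nat) : R * R * R * R * R :=
  if (i <? M)%nat then
    (- km / 2, - km / 2, 2 * km + h M ^ 2, - km / 2, - km / 2)
  else if (i =? M)%nat then
    (- km / 2, - ks / 2, km + ks + h M ^ 2, - km / 2, - ks / 2)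
  else if (i =? M + 1)%nat then
    (- ks / 2, - 1 / 2, ks + 1 + h M ^ 2, - ks / 2, - 1 / 2)
  else
    (- 1 / 2, - 1 / 2, 2 + h M ^ 2, - 1 / 2, - 1 / 2).

(* Used only for [i, j >= 1], where the truncated [i - 1], [j - 1] are exact. *)
Definition Lh (km ks : R) (M : nat) (v : nat -> nat -> R) (i j : nat) : R :=
  let '(a1, a2, a3, a4, a5) := stencil km ks M i in
  a1 * v (i - 1)%nat (j - 1)%nat + a2 * v (i + 1)%nat (j - 1)%nat
  + a3 * v i j
  + a4 * v (i - 1)%nat (j + 1)%nat + a5 * v (i + 1)%nat (j + 1)%nat.

Definition discrete_solution (km ks : R) (f : R -> R -> R) (M : nat)
    (v : nat -> nat -> R) : Prop :=
  (forall i j : nat, (1 <= i <= N M - 1)%nat -> (1 <= j <= N M - 1)%nat ->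
     Lh km ks M v i j = h M ^ 2 * f (node M i) (node M j)) /\
  (forall k : nat, (k <= N M)%nat ->
     v 0%nat k = 0 /\ v (N M) k = 0 /\ v k 0%nat = 0 /\ v k (N M) = 0).

Definition error (M : nat) (u : R -> R -> R) (v : nat -> nat -> R)
    (i j : nat) : R :=
  u (node M i) (node M j) - v i j.

Definition max_norm (M : nat) (e : nat -> nat -> R) : R :=
  fold_right Rmax 0
    (map (fun p => Rabs (e (fst p) (snd p)))
       (list_prod (seq 0 (S (N M))) (seq 0 (S (N M))))).

(* Main.v *)
From Stdlib Require Import Reals Lra Lia Arith List Classical IndefiniteDescription.
From Coquelicot Require Import Coquelicot.
Require Import Defs.
Open Scope R_scope.

(** The proof compares the nodal values of [u] with the discrete solution by
    means of a discrete maximum principle, after subtracting from [u] a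
    corrector that is discontinuous across the interface.

    Read by columns, the scheme is in flux form: up to the zeroth order term,
    its value at [(i, j)] is the flux through the edge column between [i - 1]
    and [i] minus the flux through that between [i] and [i + 1]. Away from
    the interface its truncation error is [O(h ^ 4)]. On the edge column that
    crosses the interface the discrete flux is wrong by some quantity
    [ks * omega j]; it enters the truncation error of the column [M] with one
    sign and that of [M + 1] with the other. With [omega] taken to second order
    in [h], what remains of the truncation error in these columns is
    [O(r * h)], for the quantity [r] given below.

    Such an antisymmetric error is harmless: the grid function equal to
    [omega j] left of the interface and to 0 right of it produces the same
    residual, up to [O(r * h ^ 2)] because [omega] depends smoothly on [y]
    ([Lh_corrector]). Once this
    corrector is subtracted the residual is [O(r * h ^ 2)] off the interface
    columns and [O(r * h)] on them, where
    [r = h ^ 2 + h * (|km - ks * (1 + km) / 2| + sup |u_yy (1/2, .)|)].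
    The scheme satisfies a minimum principle, and it maps a bounded piecewise
    linear function with a concave kink at the interface to a function
    bounded below by [h ^ 2], and by [h] on the interface columns
    ([Lh_barrier]). This gives the bound [O(r)] for the error
    ([corrected_convergence], [nodal_error_bound]).

    In general [r = O(h)]. Under [assumption_I] the coefficient
    [km - ks * (1 + km) / 2] and the traces of [u_yy] vanish, so that
    [r = h ^ 2]. Finally [h <= 1 / 3] gives [1 <= |ln h|].

    The Taylor expansions behind the truncation errors concern points of the
    closed subdomains, where the derivatives of [u] only exist as continuous
    extensions. They are proved in the open rectangle and carried to the closed
    one by shrinking all points towards the centre ([closed_jet], [shrink]). *)

(** * Taylor bounds in one variable *)

Fixpoint taylor_poly (phi : nat -> R -> R) (n : nat) (x t : R) : R :=
  match n with
  | O => 0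
  | S m => taylor_poly phi m x t + phi m x * ((t - x) ^ m / INR (fact m))
  end.

(** This mean value estimate is cruder than integration by a factor [n + 1];
    iterating it gives Taylor bounds whose constants carry no factorials. *)
Lemma growth_from_derivative (F F' : R -> R) (c d x K : R) (n : nat) :
  0 <= K ->
  (forall t, c < t < d -> is_derive F t (F' t)) ->
  c < x < d -> F x = 0 ->
  (forall t, c < t < d -> Rabs (F' t) <= K * Rabs (t - x) ^ n) ->
  forall t, c < t < d -> Rabs (F t) <= K * Rabs (t - x) ^ S n.
Proof.
intros HK HF Hx Fx HF' t Ht.
destruct (MVT_gen F x t F') as [z [Hz E]].
- intros s Hs. apply HF. revert Hs. unfold Rmin, Rmax.
  destruct (Rle_dec x t); lra.
- intros s Hs. apply continuity_pt_filterlim.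
  apply (ex_derive_continuous F). eexists. apply HF. revert Hs.
  unfold Rmin, Rmax. destruct (Rle_dec x t); lra.
- assert (Hzx : Rabs (z - x) <= Rabs (t - x) /\ c < z < d).
  { revert Hz. unfold Rmin, Rmax.
    destruct (Rle_dec x t); unfold Rabs; repeat destruct (Rcase_abs _); lra. }
  rewrite Fx, Rminus_0_r in E. rewrite E, Rabs_mult, Rmult_comm. simpl.
  rewrite (Rmult_comm K), Rmult_assoc.
  apply Rmult_le_compat_l; [apply Rabs_pos|].
  eapply Rle_trans; [apply HF'; apply Hzx|]. rewrite (Rmult_comm _ K).
  apply Rmult_le_compat_l; [exact HK|].
  apply pow_incr. split; [apply Rabs_pos|apply Hzx].
Qed.

(** Differentiating a Taylor polynomial shifts the sequence of derivatives, so
    that [taylor_bound] follows by induction on the order. *)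
Lemma is_derive_taylor_poly (n : nat) :
  forall (phi : nat -> R -> R) (x t : R),
  is_derive (taylor_poly phi (S n) x) t
    (taylor_poly (fun k => phi (S k)) n x t).
Proof.
induction n as [|n IH]; intros phi x t.
- simpl. auto_derive; [easy|]. ring.
- change (taylor_poly (fun k => phi (S k)) (S n) x t) with
    (taylor_poly (fun k => phi (S k)) n x t
     + phi (S n) x * ((t - x) ^ n / INR (fact n))).
  apply (is_derive_plus (taylor_poly phi (S n) x)
    (fun t => phi (S n) x * ((t - x) ^ S n / INR (fact (S n))))).
  + apply IH.
  + auto_derive; [easy|].
    change (match n with 0%nat => 1 | S _ => INR n + 1 end) with (INR (S n)).
    change (fact n + n * fact n)%nat with (S n * fact n)%nat.
    rewrite mult_INR. unfold Rminus. field.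
    split; [apply INR_fact_neq_0|apply not_0_INR; lia].
Qed.

Lemma taylor_poly_center (phi : nat -> R -> R) (n : nat) (x : R) :
  taylor_poly phi (S n) x x = phi O x.
Proof.
induction n as [|n IH].
- simpl. field.
- change (taylor_poly phi (S (S n)) x x) with
    (taylor_poly phi (S n) x x
     + phi (S n) x * ((x - x) ^ S n / INR (fact (S n)))).
  rewrite IH, Rminus_diag. simpl (0 ^ S n). unfold Rdiv. ring.
Qed.

Lemma taylor_bound (n : nat) :
  forall (phi : nat -> R -> R) (c d K : R), 0 <= K ->
  (forall k t, (k < n)%nat -> c < t < d -> is_derive (phi k) t (phi (S k) t)) ->
  (forall t, c < t < d -> Rabs (phi n t) <= K) ->
  forall x t, c < x < d -> c < t < d ->
  Rabs (phi O t - taylor_poly phi n x t) <= K * Rabs (t - x) ^ n.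
Proof.
induction n as [|n IH]; intros phi c d K HK Hd Hb x t Hx Ht.
- simpl. rewrite Rminus_0_r, Rmult_1_r. now apply Hb.
- apply (growth_from_derivative
    (fun s => phi O s - taylor_poly phi (S n) x s)
    (fun s => phi 1%nat s - taylor_poly (fun k => phi (S k)) n x s) c d);
    trivial.
  + intros s Hs. apply (is_derive_minus (phi O)).
    * apply Hd; [lia|exact Hs].
    * apply is_derive_taylor_poly.
  + rewrite taylor_poly_center. ring.
  + intros s Hs. apply (IH (fun k => phi (S k)) c d); trivial.
    intros k r Hk Hr. apply Hd; [lia|exact Hr].
Qed.

(** The first order terms of the expansions at the two outer points cancel. The
    points are given separately, rather than as a centre and a step, because in
    this form the statement is stable under affine maps of the points. *)
Lemma second_difference_bound (phi : nat -> R -> R) (c d K t0 t1 t2 : R) :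
  0 <= K ->
  (forall k t, (k < 2)%nat -> c < t < d -> is_derive (phi k) t (phi (S k) t)) ->
  (forall t, c < t < d -> Rabs (phi 2%nat t) <= K) ->
  c < t0 < d -> c < t1 < d -> c < t2 < d -> t1 - t0 = t2 - t1 ->
  Rabs (phi O t0 + phi O t2 - 2 * phi O t1) <= 2 * K * (t2 - t1) ^ 2.
Proof.
intros HK Hd Hb H0 H1 H2 E.
assert (A := taylor_bound 2 phi c d K HK Hd Hb t1 t0 H1 H0).
assert (B := taylor_bound 2 phi c d K HK Hd Hb t1 t2 H1 H2).
rewrite pow2_abs in A, B. simpl taylor_poly in A, B. simpl fact in A, B.
replace (t0 - t1) with (- (t2 - t1)) in A by lra.
apply Rabs_le_between in A, B. apply Rabs_le_between. simpl INR in *. simpl pow in *.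
set (s := t2 - t1) in *. lra.
Qed.

Lemma second_difference_taylor (phi : nat -> R -> R) (c d K t0 t1 t2 : R) :
  0 <= K ->
  (forall k t, (k < 4)%nat -> c < t < d -> is_derive (phi k) t (phi (S k) t)) ->
  (forall t, c < t < d -> Rabs (phi 4%nat t) <= K) ->
  c < t0 < d -> c < t1 < d -> c < t2 < d -> t1 - t0 = t2 - t1 ->
  Rabs (phi O t0 + phi O t2 - 2 * phi O t1 - (t2 - t1) ^ 2 * phi 2%nat t1)
    <= 2 * K * (t2 - t1) ^ 4.
Proof.
intros HK Hd Hb H0 H1 H2 E.
assert (A := taylor_bound 4 phi c d K HK Hd Hb t1 t0 H1 H0).
assert (B := taylor_bound 4 phi c d K HK Hd Hb t1 t2 H1 H2).
replace (t0 - t1) with (- (t2 - t1)) in A by lra.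
rewrite Rabs_Ropp in A.
assert (P : forall r, Rabs r ^ 4 = r ^ 4).
{ intros r. replace (Rabs r ^ 4) with ((Rabs r ^ 2) ^ 2) by ring.
  rewrite pow2_abs. ring. }
rewrite P in A, B. simpl taylor_poly in A, B. 
replace (t0 - t1) with (- (t2 - t1)) in A by lra.
apply Rabs_le_between in A, B. apply Rabs_le_between. simpl INR in *.
set (s := t2 - t1) in *. simpl pow in *. lra.
Qed.

(** * Derivatives up to the boundary of a rectangle *)

Definition right_continuous_at_0 (F : R -> R) : Prop :=
  filterlim F (at_right 0) (locally (F 0)).

Lemma rc0_const (k : R) : right_continuous_at_0 (fun _ => k).
Proof. apply filterlim_const. Qed.

Lemma rc0_plus (F1 F2 : R -> R) :
  right_continuous_at_0 F1 -> right_continuous_at_0 F2 ->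
  right_continuous_at_0 (fun e => F1 e + F2 e).
Proof.
intros H1 H2.
exact (filterlim_comp_2 _ _ _ H1 H2 (filterlim_plus (F1 0) (F2 0))).
Qed.

Lemma rc0_mult (F1 F2 : R -> R) :
  right_continuous_at_0 F1 -> right_continuous_at_0 F2 ->
  right_continuous_at_0 (fun e => F1 e * F2 e).
Proof.
intros H1 H2.
exact (filterlim_comp_2 _ _ _ H1 H2 (filterlim_mult (F1 0) (F2 0))).
Qed.

Lemma rc0_opp (F : R -> R) :
  right_continuous_at_0 F -> right_continuous_at_0 (fun e => - F e).
Proof.
intros H. exact (filterlim_comp _ _ _ F Ropp _ _ _ H (filterlim_opp (F 0))).
Qed.

Lemma rc0_minus (F1 F2 : R -> R) :
  right_continuous_at_0 F1 -> right_continuous_at_0 F2 ->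
  right_continuous_at_0 (fun e => F1 e - F2 e).
Proof. intros H1 H2. apply rc0_plus; [exact H1|now apply rc0_opp]. Qed.

Lemma rc0_pow (F : R -> R) (n : nat) :
  right_continuous_at_0 F -> right_continuous_at_0 (fun e => F e ^ n).
Proof.
intros H. induction n as [|n IH]; [apply rc0_const|].
exact (rc0_mult _ _ H IH).
Qed.

Lemma rc0_Rabs (F : R -> R) :
  right_continuous_at_0 F -> right_continuous_at_0 (fun e => Rabs (F e)).
Proof.
intros H. exact (filterlim_comp _ _ _ F Rabs _ _ _ H (continuous_Rabs (F 0))).
Qed.

(** The contraction by [1 - e] towards the centre of [[a, b]]. It moves the closed
    rectangle into the open one and is affine, so it keeps points aligned and
    equally spaced. *)
Definition shrink (a b x e : R) : R := x + e * ((a + b) / 2 - x).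

Lemma shrink_0 (a b x : R) : shrink a b x 0 = x.
Proof. unfold shrink. ring. Qed.

Lemma shrink_interior (a b x e : R) :
  a < b -> a <= x <= b -> 0 < e < 1 -> a < shrink a b x e < b.
Proof. intros H Hx He. unfold shrink. nra. Qed.

Lemma rc0_shrink (a b x : R) : right_continuous_at_0 (shrink a b x).
Proof.
apply rc0_plus; [apply rc0_const|].
apply rc0_mult; [|apply rc0_const].
unfold right_continuous_at_0, at_right. intros P HP. unfold filtermap, within.
  revert HP. apply filter_imp. intros e He _. exact He.
Qed.

Lemma rc0_shrink_point (a b : R) (g : R -> R -> R) (x y : R) :
  a < b -> continuous_on_set (rect_bar a b) g -> rect_bar a b (x, y) ->
  right_continuous_at_0 (fun e => g (shrink a b x e) (shrink 0 1 y e)).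
Proof.
intros Hab Hg Hxy. unfold right_continuous_at_0. rewrite !shrink_0.
apply (filterlim_comp _ _ _
  (fun e => (shrink a b x e, shrink 0 1 y e))
  (fun p : R * R => g (fst p) (snd p)) _
  (within (rect_bar a b) (locally (x, y)))); [|now apply Hg].
assert (Hin : at_right 0
  (fun e => rect_bar a b (shrink a b x e, shrink 0 1 y e))).
{ exists (mkposreal 1 Rlt_0_1). intros e He Hpos. simpl in He.
  assert (He1 : 0 < e < 1).
  { split; [exact Hpos|].
    unfold ball in He; simpl in He; unfold AbsRing_ball, abs, minus, plus, opp in He.
    simpl in He. apply Rabs_lt_between in He. lra. }
  destruct Hxy as [Hx Hy]. simpl in Hx, Hy.
  assert (A := shrink_interior a b x e Hab Hx He1).
  assert (B := shrink_interior 0 1 y e Rlt_0_1 Hy He1).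
  split; simpl; lra. }
assert (Hlim : filterlim (fun e => (shrink a b x e, shrink 0 1 y e))
  (at_right 0) (locally (x, y))).
{ assert (A := rc0_shrink a b x). assert (B := rc0_shrink 0 1 y).
  unfold right_continuous_at_0 in A, B. rewrite shrink_0 in A, B.
  intros P [eps HP].
  assert (A' := A _ (locally_ball x eps)). assert (B' := B _ (locally_ball y eps)).
  unfold filtermap in *.
  generalize (filter_and _ _ A' B'). apply filter_imp.
  intros e [E1 E2]. apply HP. split; assumption. }
intros P HP. unfold filtermap, within in *.
generalize (filter_and _ _ Hin (Hlim _ HP)). apply filter_imp.
intros e [E1 E2]. now apply E2.
Qed.

(** The device that carries an inequality between derivatives from the open
    rectangle to the closed one: it holds at the shrunken points, and then [e]
    tends to 0. *)
Lemma le_at_0_of_right (F1 F2 : R -> R) :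
  right_continuous_at_0 F1 -> right_continuous_at_0 F2 ->
  (forall e, 0 < e < 1 -> F1 e <= F2 e) -> F1 0 <= F2 0.
Proof.
intros H1 H2 H.
apply (filterlim_le (F := at_right 0) F1 F2 (F1 0) (F2 0)); trivial.
exists (mkposreal 1 Rlt_0_1). intros e He Hpos. apply H.
split; [exact Hpos|].
unfold ball in He; simpl in He; unfold AbsRing_ball, abs, minus, plus, opp in He.
simpl in He. apply Rabs_lt_between in He. lra.
Qed.

(** [G m n] stands for the continuous extension of the derivative of order [m]
    in [x] and [n] in [y] to the closed rectangle, bounded by [K]. Order 4 is
    what the truncation error of the scheme involves. *)
Definition closed_jet (a b K : R) (G : nat -> nat -> R -> R -> R) : Prop :=
  (forall m n, (m + n <= 4)%nat -> continuous_on_set (rect_bar a b) (G m n)) /\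
  (forall m n x y, (m + n <= 4)%nat -> rect_bar a b (x, y) ->
     Rabs (G m n x y) <= K) /\
  (forall m n x y, (m + n < 4)%nat -> rect a b (x, y) ->
     is_derive (fun s => G m n s y) x (G (S m) n x y) /\
     is_derive (fun t => G m n x t) y (G m (S n) x y)).

Lemma jet_bound_nonneg (a b K : R) (G : nat -> nat -> R -> R -> R) :
  a < b -> closed_jet a b K G -> 0 <= K.
Proof.
intros Hab [_ [HB _]].
eapply Rle_trans; [apply Rabs_pos|].
apply (HB 0%nat 0%nat ((a + b) / 2) (1 / 2)); [lia|split; simpl; lra].
Qed.

(* Continuity in [e] of expressions built from derivatives at shrunken points. *)
Ltac solve_rc0 Hab Hc :=
  lazymatch goal with
  | |- right_continuous_at_0 (fun e => ?A - ?B) =>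
      apply (rc0_minus (fun e => A) (fun e => B)); solve_rc0 Hab Hc
  | |- right_continuous_at_0 (fun e => ?A + ?B) =>
      apply (rc0_plus (fun e => A) (fun e => B)); solve_rc0 Hab Hc
  | |- right_continuous_at_0 (fun e => ?A * ?B) =>
      apply (rc0_mult (fun e => A) (fun e => B)); solve_rc0 Hab Hc
  | |- right_continuous_at_0 (fun e => ?A ^ ?n) =>
      apply (rc0_pow (fun e => A) n); solve_rc0 Hab Hc
  | |- right_continuous_at_0 (fun e => Rabs ?A) =>
      apply (rc0_Rabs (fun e => A)); solve_rc0 Hab Hc
  | |- right_continuous_at_0 (fun e => shrink _ _ _ e) => apply rc0_shrink
  | |- right_continuous_at_0 (shrink _ _ _) => apply rc0_shrink
  | |- right_continuous_at_0 (fun e => ?G ?m ?n (shrink ?a ?b ?x e) (shrink 0 1 ?y e)) =>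
      apply (rc0_shrink_point a b (G m n) x y); [exact Hab|apply Hc; lia|]
  | |- _ => apply rc0_const
  end.

Lemma rc0_taylor_poly (phi : R -> nat -> R -> R) (n : nat) (x t : R -> R) :
  right_continuous_at_0 x -> right_continuous_at_0 t ->
  (forall k, (k < n)%nat -> right_continuous_at_0 (fun e => phi e k (x e))) ->
  right_continuous_at_0 (fun e => taylor_poly (phi e) n (x e) (t e)).
Proof.
intros Hx Ht. induction n as [|n IH]; intros Hphi; simpl.
- apply rc0_const.
- apply rc0_plus; [apply IH; intros k Hk; apply Hphi; lia|].
  apply rc0_mult; [apply Hphi; lia|].
  apply rc0_mult; [|apply rc0_const].
  apply rc0_pow, rc0_minus; assumption.
Qed.

Lemma jet_taylor_x (a b K : R) (G : nat -> nat -> R -> R -> R) (m n p : nat) :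
  a < b -> closed_jet a b K G -> (p + m + n <= 4)%nat ->
  forall x x' y, rect_bar a b (x, y) -> rect_bar a b (x', y) ->
  Rabs (G m n x' y - taylor_poly (fun k s => G (k + m)%nat n s y) p x x')
    <= K * Rabs (x' - x) ^ p.
Proof.
intros Hab HG Hmn x x' y Hx Hx'.
assert (HK := jet_bound_nonneg a b K G Hab HG).
destruct HG as [Hc [HB HD]].
set (X := shrink a b x). set (X' := shrink a b x'). set (Y := shrink 0 1 y).
rewrite <- (shrink_0 a b x), <- (shrink_0 a b x'), <- (shrink_0 0 1 y).
fold X X' Y.
apply (le_at_0_of_right
  (fun e => Rabs (G m n (X' e) (Y e)
      - taylor_poly (fun k s => G (k + m)%nat n s (Y e)) p (X e) (X' e)))
  (fun e => K * Rabs (X' e - X e) ^ p)).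
- apply rc0_Rabs, rc0_minus.
  + apply rc0_shrink_point; [exact Hab|apply Hc; lia|exact Hx'].
  + apply (rc0_taylor_poly (fun e k s => G (k + m)%nat n s (Y e)));
      try apply rc0_shrink.
    intros k Hk. apply rc0_shrink_point; [exact Hab|apply Hc; lia|exact Hx].
- unfold X, X'. solve_rc0 Hab Hc.
- intros e He.
  assert (IX := shrink_interior a b x e Hab (proj1 Hx) He).
  assert (IX' := shrink_interior a b x' e Hab (proj1 Hx') He).
  assert (IY := shrink_interior 0 1 y e Rlt_0_1 (proj2 Hx) He).
  simpl in IX, IX', IY. fold X X' Y in IX, IX', IY.
  apply (taylor_bound p (fun k s => G (k + m)%nat n s (Y e)) a b K HK); trivial.
  + intros k t Hk Ht. apply (HD (k + m)%nat n t (Y e)); [lia|split; assumption].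
  + intros t Ht. apply HB; [lia|split; simpl; lra].
Qed.

Lemma jet_second_difference_y (a b K : R) (G : nat -> nat -> R -> R -> R)
    (m n : nat) :
  a < b -> closed_jet a b K G -> (m + n <= 2)%nat ->
  forall x y0 y1 y2, rect_bar a b (x, y0) -> rect_bar a b (x, y1) ->
  rect_bar a b (x, y2) -> y1 - y0 = y2 - y1 ->
  Rabs (G m n x y0 + G m n x y2 - 2 * G m n x y1) <= 2 * K * (y2 - y1) ^ 2.
Proof.
intros Hab HG Hmn x y0 y1 y2 H0 H1 H2 E.
assert (HK := jet_bound_nonneg a b K G Hab HG).
destruct HG as [Hc [HB HD]].
set (X := shrink a b x). set (Y0 := shrink 0 1 y0).
set (Y1 := shrink 0 1 y1). set (Y2 := shrink 0 1 y2).
rewrite <- (shrink_0 a b x), <- (shrink_0 0 1 y0), <- (shrink_0 0 1 y1),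
  <- (shrink_0 0 1 y2).
fold X Y0 Y1 Y2.
apply (le_at_0_of_right
  (fun e => Rabs (G m n (X e) (Y0 e) + G m n (X e) (Y2 e) - 2 * G m n (X e) (Y1 e)))
  (fun e => 2 * K * (Y2 e - Y1 e) ^ 2)).
- unfold X, Y0, Y1, Y2. solve_rc0 Hab Hc; assumption.
- unfold Y1, Y2. solve_rc0 Hab Hc.
- intros e He.
  assert (IX := shrink_interior a b x e Hab (proj1 H0) He).
  assert (I0 := shrink_interior 0 1 y0 e Rlt_0_1 (proj2 H0) He).
  assert (I1 := shrink_interior 0 1 y1 e Rlt_0_1 (proj2 H1) He).
  assert (I2 := shrink_interior 0 1 y2 e Rlt_0_1 (proj2 H2) He).
  simpl in *. fold X Y0 Y1 Y2 in IX, I0, I1, I2.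
  apply (second_difference_bound (fun k t => G m (k + n)%nat (X e) t) 0 1);
    trivial.
  + intros k t Hk Ht. apply (HD m (k + n)%nat (X e) t); [lia|split; assumption].
  + intros t Ht. apply HB; [lia|split; simpl; lra].
  + unfold Y0, Y1, Y2, shrink. nra.
Qed.

Lemma jet_second_difference_taylor_y (a b K : R)
    (G : nat -> nat -> R -> R -> R) :
  a < b -> closed_jet a b K G ->
  forall x y0 y1 y2, rect_bar a b (x, y0) -> rect_bar a b (x, y1) ->
  rect_bar a b (x, y2) -> y1 - y0 = y2 - y1 ->
  Rabs (G 0%nat 0%nat x y0 + G 0%nat 0%nat x y2 - 2 * G 0%nat 0%nat x y1
        - (y2 - y1) ^ 2 * G 0%nat 2%nat x y1)
    <= 2 * K * (y2 - y1) ^ 4.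
Proof.
intros Hab HG x y0 y1 y2 H0 H1 H2 E.
assert (HK := jet_bound_nonneg a b K G Hab HG).
destruct HG as [Hc [HB HD]].
set (X := shrink a b x). set (Y0 := shrink 0 1 y0).
set (Y1 := shrink 0 1 y1). set (Y2 := shrink 0 1 y2).
rewrite <- (shrink_0 a b x), <- (shrink_0 0 1 y0), <- (shrink_0 0 1 y1),
  <- (shrink_0 0 1 y2).
fold X Y0 Y1 Y2.
apply (le_at_0_of_right
  (fun e => Rabs (G 0%nat 0%nat (X e) (Y0 e) + G 0%nat 0%nat (X e) (Y2 e)
     - 2 * G 0%nat 0%nat (X e) (Y1 e)
     - (Y2 e - Y1 e) ^ 2 * G 0%nat 2%nat (X e) (Y1 e)))
  (fun e => 2 * K * (Y2 e - Y1 e) ^ 4)).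
- unfold X, Y0, Y1, Y2. solve_rc0 Hab Hc; assumption.
- unfold Y1, Y2. solve_rc0 Hab Hc.
- intros e He.
  assert (IX := shrink_interior a b x e Hab (proj1 H0) He).
  assert (I0 := shrink_interior 0 1 y0 e Rlt_0_1 (proj2 H0) He).
  assert (I1 := shrink_interior 0 1 y1 e Rlt_0_1 (proj2 H1) He).
  assert (I2 := shrink_interior 0 1 y2 e Rlt_0_1 (proj2 H2) He).
  simpl in H0, H1, H2, IX, I0, I1, I2. fold X Y0 Y1 Y2 in IX, I0, I1, I2.
  apply (second_difference_taylor (fun k t => G 0%nat k (X e) t) 0 1);
    trivial.
  + intros k t Hk Ht. apply (HD 0%nat k (X e) t); [lia|split; assumption].
  + intros t Ht. apply HB; [lia|split; simpl; lra].
  + unfold Y0, Y1, Y2, shrink. nra.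
Qed.

(** The sum over the four diagonal neighbours is
    [(2 + dx) (2 + dy) u - 4 u = 2 dx u + 2 dy u + dx dy u] with the second
    difference operators [dx] and [dy]. The first two terms give the Laplacian
    by one-dimensional Taylor formulas. The last one is a second difference in
    [y] of [dx u], whose second derivative in [y] is again a second difference,
    in [x], of [u_yy]. *)
Lemma jet_diagonal_laplacian_open (a b K : R) (G : nat -> nat -> R -> R -> R) :
  a < b -> closed_jet a b K G ->
  forall x0 x1 x2 y0 y1 y2 d,
  a < x0 < b -> a < x1 < b -> a < x2 < b ->
  0 < y0 < 1 -> 0 < y1 < 1 -> 0 < y2 < 1 ->
  x1 - x0 = d -> x2 - x1 = d -> y1 - y0 = d -> y2 - y1 = d ->
  Rabs (G 0%nat 0%nat x0 y0 + G 0%nat 0%nat x2 y0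
        + G 0%nat 0%nat x0 y2 + G 0%nat 0%nat x2 y2 - 4 * G 0%nat 0%nat x1 y1
        - 2 * d ^ 2 * (G 2%nat 0%nat x1 y1 + G 0%nat 2%nat x1 y1))
    <= 12 * K * d ^ 4.
Proof.
intros Hab HG x0 x1 x2 y0 y1 y2 d X0 X1 X2 Y0 Y1 Y2 E1 E2 E3 E4.
assert (HK := jet_bound_nonneg a b K G Hab HG).
destruct HG as [Hc [HB HD]].
assert (Ax := second_difference_taylor (fun k s => G k 0%nat s y1) a b K
  x0 x1 x2 HK).
assert (Ay := second_difference_taylor (fun k t => G 0%nat k x1 t) 0 1 K
  y0 y1 y2 HK).
assert (Axy := second_difference_bound
  (fun k t => G 0%nat k x0 t + G 0%nat k x2 t - 2 * G 0%nat k x1 t) 0 1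
  (2 * K * d ^ 2) y0 y1 y2).
simpl (fun _ => _) in Ax, Ay, Axy.
rewrite E2 in Ax. rewrite E4 in Ay, Axy.
lapply Ax; clear Ax; [intros Ax|
  intros k t Hk Ht; apply (HD k 0%nat t y1); [lia|split; assumption]].
lapply Ax; clear Ax; [intros Ax|
  intros t Ht; apply HB; [lia|split; simpl; lra]].
specialize (Ax X0 X1 X2 E1).
lapply Ay; clear Ay; [intros Ay|
  intros k t Hk Ht; apply (HD 0%nat k x1 t); [lia|split; assumption]].
lapply Ay; clear Ay; [intros Ay|
  intros t Ht; apply HB; [lia|split; simpl; lra]].
specialize (Ay Y0 Y1 Y2 E3).
lapply Axy; clear Axy; [intros Axy|assert (Q := pow2_ge_0 d); nra].
lapply Axy; clear Axy; [intros Axy|].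
2:{ intros k t Hk Ht.
    apply (is_derive_minus (fun t => G 0%nat k x0 t + G 0%nat k x2 t)
      (fun t => 2 * G 0%nat k x1 t)).
    - apply (is_derive_plus (G 0%nat k x0) (G 0%nat k x2));
      apply (HD 0%nat k _ t); try lia; split; simpl; assumption.
    - apply (is_derive_scal (G 0%nat k x1)).
      apply (HD 0%nat k _ t); try lia; split; simpl; assumption. }
lapply Axy; clear Axy; [intros Axy|].
2:{ intros t Ht. rewrite <- E2.
    apply (second_difference_bound (fun k s => G k 2%nat s t) a b K); trivial.
    - intros k s Hk Hs. apply (HD k 2%nat s t); [lia|split; assumption].
    - intros s Hs. apply HB; [lia|split; simpl; lra].
    - lra. }
specialize (Axy Y0 Y1 Y2 E3). cbv beta in Axy.
apply Rabs_le_between in Ax, Ay, Axy. apply Rabs_le_between.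
replace (2 * (2 * K * d ^ 2) * d ^ 2) with (4 * (K * d ^ 4)) in Axy by ring.
replace (2 * K * d ^ 4) with (2 * (K * d ^ 4)) in Ax, Ay by ring.
replace (12 * K * d ^ 4) with (12 * (K * d ^ 4)) by ring.
lra.
Qed.

Lemma jet_diagonal_laplacian (a b K : R) (G : nat -> nat -> R -> R -> R) :
  a < b -> closed_jet a b K G ->
  forall x0 x1 x2 y0 y1 y2 d,
  a <= x0 <= b -> a <= x1 <= b -> a <= x2 <= b ->
  0 <= y0 <= 1 -> 0 <= y1 <= 1 -> 0 <= y2 <= 1 ->
  x1 - x0 = d -> x2 - x1 = d -> y1 - y0 = d -> y2 - y1 = d ->
  Rabs (G 0%nat 0%nat x0 y0 + G 0%nat 0%nat x2 y0
        + G 0%nat 0%nat x0 y2 + G 0%nat 0%nat x2 y2 - 4 * G 0%nat 0%nat x1 y1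
        - 2 * d ^ 2 * (G 2%nat 0%nat x1 y1 + G 0%nat 2%nat x1 y1))
    <= 12 * K * d ^ 4.
Proof.
intros Hab HG x0 x1 x2 y0 y1 y2 d X0 X1 X2 Y0 Y1 Y2 E1 E2 E3 E4.
assert (HG' := HG). destruct HG' as [Hc _].
rewrite <- E4.
rewrite <- (shrink_0 a b x0), <- (shrink_0 a b x1), <- (shrink_0 a b x2),
  <- (shrink_0 0 1 y0), <- (shrink_0 0 1 y1), <- (shrink_0 0 1 y2).
apply (le_at_0_of_right
  (fun e => Rabs (G 0%nat 0%nat (shrink a b x0 e) (shrink 0 1 y0 e)
     + G 0%nat 0%nat (shrink a b x2 e) (shrink 0 1 y0 e)
     + G 0%nat 0%nat (shrink a b x0 e) (shrink 0 1 y2 e)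
     + G 0%nat 0%nat (shrink a b x2 e) (shrink 0 1 y2 e)
     - 4 * G 0%nat 0%nat (shrink a b x1 e) (shrink 0 1 y1 e)
     - 2 * (shrink 0 1 y2 e - shrink 0 1 y1 e) ^ 2
       * (G 2%nat 0%nat (shrink a b x1 e) (shrink 0 1 y1 e)
          + G 0%nat 2%nat (shrink a b x1 e) (shrink 0 1 y1 e))))
  (fun e => 12 * K * (shrink 0 1 y2 e - shrink 0 1 y1 e) ^ 4)).
- solve_rc0 Hab Hc; split; assumption.
- solve_rc0 Hab Hc.
- intros e He. apply (jet_diagonal_laplacian_open a b); trivial;
    try (apply shrink_interior; lra);
    unfold shrink; nra.
Qed.

(** * Extended derivatives of functions of class C^k *)

Lemma list_upper_bound (T : Type) (f : T -> R) (l : list T) :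
  exists K, forall t, In t l -> f t <= K.
Proof.
induction l as [|t0 l [K HK]].
- exists 0. intros t [].
- exists (Rmax (f t0) K). intros t [<-|Ht]; [apply Rmax_l|].
  eapply Rle_trans; [now apply HK|apply Rmax_r].
Qed.

(** Continuity bounds [g] by [|g| + 1] at the centre on a small box around each
    point; compactness leaves finitely many centres. *)
Lemma continuous_on_closed_rect_bounded (a b : R) (g : R -> R -> R) :
  continuous_on_set (rect_bar a b) g ->
  exists K, forall x y, rect_bar a b (x, y) -> Rabs (g x y) <= K.
Proof.
intros Hg.
destruct (functional_choice (fun (p : Compactness.Tn 2 R) (d : posreal) =>
  let '(x, (y, _)) := p in rect_bar a b (x, y) ->
  forall x' y', rect_bar a b (x', y') ->
  Rabs (x' - x) < d -> Rabs (y' - y) < d -> Rabs (g x' y') <= Rabs (g x y) + 1))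
  as [delta Hdelta].
{ intros [x [y []]].
  destruct (classic (rect_bar a b (x, y))) as [Hxy|Hxy];
    [|exists (mkposreal 1 Rlt_0_1); intros H; contradiction].
  destruct (Hg x y Hxy _ (locally_ball (g x y) (mkposreal 1 Rlt_0_1)))
    as [d Hd].
  exists d. intros _ x' y' H' Dx Dy.
  assert (B := Hd (x', y') (conj Dx Dy) H').
  unfold ball in B; simpl in B; unfold AbsRing_ball, abs, minus, plus, opp in B.
  simpl in B. fold (Rminus (g x' y') (g x y)) in B.
  apply Rabs_lt_between in B. unfold Rabs; repeat destruct (Rcase_abs _); lra. }
apply NNPP. intros Hno.
apply (compactness_list 2 (a, (0, tt)) (b, (1, tt)) delta).
intros [l Hl]. apply Hno.
destruct (list_upper_bound _ (fun p : Compactness.Tn 2 R =>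
  let '(x, (y, _)) := p in Rabs (g x y) + 1) l) as [K HK].
exists K. intros x y Hxy.
destruct (Hl (x, (y, tt))) as [[x0 [y0 []]] [Hin [Hb Hclose]]].
{ destruct Hxy as [Hx Hy]. simpl in *. tauto. }
eapply Rle_trans; [|apply (HK _ Hin)].
simpl in Hb, Hclose.
apply (Hdelta (x0, (y0, tt))); try tauto. split; simpl; tauto.
Qed.

Lemma locally_open_interval (c d x : R) :
  c < x < d -> locally x (fun s : R => c < s < d).
Proof.
intros Hx.
apply (filter_and (fun s : R => c < s) (fun s : R => s < d));
  [apply open_gt|apply open_lt]; apply Hx.
Qed.

Lemma locally_2d_rect (a b x y : R) (P : R -> R -> Prop) :
  (forall x y, rect a b (x, y) -> P x y) -> rect a b (x, y) ->
  locally_2d P x y.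
Proof.
intros HP [Hx Hy]. apply locally_2d_locally.
assert (A := locally_open_interval a b x Hx).
assert (B := locally_open_interval 0 1 y Hy).
destruct A as [d1 A]. destruct B as [d2 B].
exists (mkposreal _ (Rmin_pos _ _ (cond_pos d1) (cond_pos d2))).
intros [s t] [Hs Ht]. apply HP. split.
- apply A. eapply ball_le; [|exact Hs]. apply Rmin_l.
- apply B. eapply ball_le; [|exact Ht]. apply Rmin_r.
Qed.

(** The extensions are chosen simultaneously for all orders, with [u] itself at
    order 0. The derivative in [y] of a mixed derivative is again one by
    Schwarz's theorem. *)
Lemma closed_jet_of_Ck (a b : R) (u : R -> R -> R) :
  Ck_closed_rect 6 a b u ->
  exists G K, closed_jet a b K G /\
    (forall x y, G 0%nat 0%nat x y = u x y) /\
    (forall m n x y, (m + n <= 4)%nat -> rect a b (x, y) ->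
       G m n x y = partial_derive m n u x y).
Proof.
intros [Hdiff [Hcont Hder]].
destruct (functional_choice (fun (p : nat * nat) (g : R -> R -> R) =>
  (fst p + snd p <= 4)%nat ->
  continuous_on_set (rect_bar a b) g /\
  (p = (0%nat, 0%nat) -> g = u) /\
  forall x y, rect a b (x, y) -> g x y = partial_derive (fst p) (snd p) u x y))
  as [G HG].
{ intros [m n]. simpl.
  destruct (Nat.eq_dec (m + n) 0) as [E|E].
  - assert (m = 0%nat) by lia. assert (n = 0%nat) by lia. subst.
    exists u. intros _. repeat split; auto.
  - destruct (le_lt_dec (m + n) 4) as [L|L]; [|exists u; lia].
    destruct (Hder m n) as [g [Hg1 Hg2]]; [lia|].
    exists g. intros _. repeat split; auto.
    intros E'. injection E' as -> ->. lia. }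
destruct (functional_choice (fun (p : nat * nat) (K : R) =>
  (fst p + snd p <= 4)%nat ->
  forall x y, rect_bar a b (x, y) -> Rabs (G p x y) <= K)) as [Kf HKf].
{ intros p. destruct (le_lt_dec (fst p + snd p) 4) as [L|L].
  - destruct (continuous_on_closed_rect_bounded a b (G p)) as [K HK].
    + now apply HG.
    + now exists K.
  - exists 0. lia. }
destruct (list_upper_bound _ Kf (list_prod (seq 0 5) (seq 0 5))) as [K HK].
exists (fun m n => G (m, n)), K.
assert (HE : forall m n x y, (m + n <= 4)%nat -> rect a b (x, y) ->
  G (m, n) x y = partial_derive m n u x y).
{ intros m n x y L. now apply (HG (m, n)). }
split; [|split; [|exact HE]].
2:{ intros x y. destruct (HG (0%nat, 0%nat)) as [_ [E _]]; [simpl; lia|].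
    now rewrite E. }
split; [|split].
- intros m n L. now apply (HG (m, n)).
- intros m n x y L Hxy. eapply Rle_trans; [now apply (HKf (m, n))|].
  apply HK, in_prod; apply in_seq; lia.
- intros m n x y L Hxy. rewrite !HE by (try lia; exact Hxy).
  destruct Hxy as [Hx Hy]. simpl in Hx, Hy. split.
  + apply (is_derive_ext_loc (fun s => partial_derive m n u s y)).
    * generalize (locally_open_interval a b x Hx). apply filter_imp.
      intros s Hs. symmetry. apply HE; [lia|split; assumption].
    * apply (Derive_correct (fun s => partial_derive m n u s y)).
      apply (ex_diff_n_ex_deriv_inf_1 6); [lia|].
      apply Hdiff. split; assumption.
  + apply (is_derive_ext_loc (fun t => partial_derive m n u x t)).
    * generalize (locally_open_interval 0 1 y Hy). apply filter_imp.
      intros t Ht. symmetry. apply HE; [lia|split; assumption].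
    * rewrite <- (Derive_partial_derive m n u x y).
      -- apply (Derive_correct (fun t => partial_derive m n u x t)).
         apply (ex_diff_n_ex_deriv_inf_2 6); [lia|].
         apply Hdiff. split; assumption.
      -- apply (locally_2d_rect a b); [|split; assumption].
         intros x' y' H'. apply (ex_diff_n_m 6); [lia|]. now apply Hdiff.
Qed.

(** * Discrete maximum principle and corrector *)

Lemma h_times_N (M : nat) : h M * (2 * INR M + 1) = 1.
Proof.
unfold h, N. rewrite plus_INR, mult_INR. simpl (INR 2). simpl (INR 1).
assert (P := pos_INR M). field. lra.
Qed.

Lemma h_bounds (M : nat) : (1 <= M)%nat -> 0 < h M <= 1 / 3.
Proof.
intros HM. assert (E := h_times_N M).
assert (P : 1 <= INR M) by (apply (le_INR 1); exact HM).
split; nra.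
Qed.

(** The coefficient of the edges from column [i] to column [i + 1]; [ks] belongs to
    those crossing the interface. *)
Definition edge (km ks : R) (M i : nat) : R :=
  if (i <? M)%nat then km else if (i =? M)%nat then ks else 1.

(** The flux form of the scheme. It shows at once that off-diagonal entries are
    negative and that rows sum to [h ^ 2]. *)
Lemma Lh_edge (km ks : R) (M : nat) (v : nat -> nat -> R) (i j : nat) :
  (1 <= i)%nat ->
  Lh km ks M v i j =
    edge km ks M (i - 1)
      * (v i j - (v (i - 1)%nat (j - 1)%nat + v (i - 1)%nat (j + 1)%nat) / 2)
    + edge km ks M i
      * (v i j - (v (i + 1)%nat (j - 1)%nat + v (i + 1)%nat (j + 1)%nat) / 2)
    + h M ^ 2 * v i j.
Proof.
intros Hi. unfold Lh, stencil, edge.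
destruct (Nat.ltb_spec i M); destruct (Nat.ltb_spec (i - 1) M);
  destruct (Nat.eqb_spec i M); destruct (Nat.eqb_spec (i - 1) M);
  destruct (Nat.eqb_spec i (M + 1)); try lia; field.
Qed.

Lemma edge_pos (km ks : R) (M i : nat) : 0 < km -> 0 < ks -> 0 < edge km ks M i.
Proof.
intros Hk Hs. unfold edge. destruct (i <? M); [|destruct (i =? M)]; lra.
Qed.

Lemma list_argmin (T : Type) (f : T -> R) (l : list T) :
  l <> nil -> exists t, In t l /\ forall s, In s l -> f t <= f s.
Proof.
induction l as [|t0 l IH]; [easy|]. intros _.
destruct l as [|t1 l].
- exists t0. split; [now left|]. intros s [<-|[]]. lra.
- destruct IH as [t [Ht Hmin]]; [easy|].
  destruct (Rle_dec (f t0) (f t)) as [L|L].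
  + exists t0. split; [now left|]. intros s [<-|Hs]; [lra|].
    specialize (Hmin s Hs). lra.
  + exists t. split; [now right|]. intros s [<-|Hs]; [lra|]. now apply Hmin.
Qed.

Definition on_boundary (M i j : nat) : Prop :=
  i = 0%nat \/ i = N M \/ j = 0%nat \/ j = N M.

(** At an interior minimum both edge terms are at most 0, so that
    [h ^ 2 * F] is at least [Lh F], hence nonnegative. *)
Lemma discrete_minimum_principle (km ks : R) (M : nat) (F : nat -> nat -> R) :
  (1 <= M)%nat -> 0 < km -> 0 < ks ->
  (forall i j, (1 <= i <= N M - 1)%nat -> (1 <= j <= N M - 1)%nat ->
     0 <= Lh km ks M F i j) ->
  (forall i j, (i <= N M)%nat -> (j <= N M)%nat -> on_boundary M i j ->
     0 <= F i j) ->
  forall i j, (i <= N M)%nat -> (j <= N M)%nat -> 0 <= F i j.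
Proof.
intros HM Hk Hs HL HB i j Hi Hj.
destruct (list_argmin _ (fun p => F (fst p) (snd p))
  (list_prod (seq 0 (S (N M))) (seq 0 (S (N M))))) as [[i0 j0] [Hin Hmin]].
{ simpl. easy. }
apply in_prod_iff in Hin. destruct Hin as [Hi0 Hj0].
apply in_seq in Hi0, Hj0.
assert (Hm : forall k l, (k <= N M)%nat -> (l <= N M)%nat -> F i0 j0 <= F k l).
{ intros k l Hk' Hl'. apply (Hmin (k, l)). apply in_prod; apply in_seq; lia. }
clear Hmin. simpl in Hi0, Hj0.
apply Rle_trans with (F i0 j0); [|now apply Hm].
destruct (classic (on_boundary M i0 j0)) as [Hb|Hb]; [apply HB; trivial; lia|].
unfold on_boundary in Hb.
assert (HLij := HL i0 j0 ltac:(lia) ltac:(lia)).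
rewrite Lh_edge in HLij by lia.
assert (A := edge_pos km ks M (i0 - 1) Hk Hs).
assert (B := edge_pos km ks M i0 Hk Hs).
assert (Hh := h_bounds M HM).
assert (F1 := Hm (i0 - 1)%nat (j0 - 1)%nat ltac:(lia) ltac:(lia)).
assert (F2 := Hm (i0 - 1)%nat (j0 + 1)%nat ltac:(lia) ltac:(lia)).
assert (F3 := Hm (i0 + 1)%nat (j0 - 1)%nat ltac:(lia) ltac:(lia)).
assert (F4 := Hm (i0 + 1)%nat (j0 + 1)%nat ltac:(lia) ltac:(lia)).
assert (H2 : 0 < h M ^ 2) by (apply pow_lt; lra).
destruct (Rle_dec 0 (F i0 j0)) as [|Hneg]; [assumption|exfalso].
assert (edge km ks M (i0 - 1) * (F i0 j0 - (F (i0 - 1)%nat (j0 - 1)%nat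
  + F (i0 - 1)%nat (j0 + 1)%nat) / 2) <= 0) by nra.
assert (edge km ks M i0 * (F i0 j0 - (F (i0 + 1)%nat (j0 - 1)%nat
  + F (i0 + 1)%nat (j0 + 1)%nat) / 2) <= 0) by nra.
nra.
Qed.

(** Constant left of the interface, of slope -2 right of it. The step [h / ks]
    across the interface makes the discrete flux there equal to [- h], halfway
    between 0 and [- 2 * h], so that the kink gives [h] to each of the columns
    [M] and [M + 1]. *)
Definition barrier (ks : R) (M i : nat) : R :=
  if (i <=? M)%nat then 3
  else 3 - h M / ks - 2 * (INR i - INR M - 1) * h M.

Lemma barrier_bounds (ks : R) (M i : nat) :
  (1 <= M)%nat -> 1 <= ks -> (i <= N M)%nat -> 1 <= barrier ks M i <= 3.
Proof.
intros HM Hs Hi. unfold barrier. destruct (Nat.leb_spec i M) as [L|L]; [lra|].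
assert (Hh := h_bounds M HM). assert (E := h_times_N M).
assert (A : INR M + 1 <= INR i).
{ rewrite <- S_INR. apply le_INR. lia. }
assert (B : INR i <= 2 * INR M + 1).
{ apply le_INR in Hi. unfold N in Hi. rewrite plus_INR, mult_INR in Hi.
  simpl in Hi. lra. }
assert (D : 0 < h M / ks <= h M).
{ split; [apply Rdiv_lt_0_compat; lra|].
  apply Rmult_le_reg_r with ks; [lra|]. unfold Rdiv.
  rewrite Rmult_assoc, Rinv_l by lra. nra. }
split; nra.
Qed.

Lemma Lh_barrier (km ks : R) (M i j : nat) :
  (1 <= M)%nat -> 1 <= ks -> (1 <= i <= N M - 1)%nat ->
  h M ^ 2 + (if ((i =? M) || (i =? M + 1))%nat%bool then h M else 0)
    <= Lh km ks M (fun i _ => barrier ks M i) i j.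
Proof.
intros HM Hs Hi. rewrite Lh_edge by lia.
assert (Hh := h_bounds M HM).
assert (Bi := barrier_bounds ks M i HM Hs ltac:(lia)).
assert (H2 : 0 < h M ^ 2) by (apply pow_lt; lra).
assert (H3 : h M ^ 2 <= h M ^ 2 * barrier ks M i) by nra.
unfold edge. unfold barrier at 1 2 3 4 5 6.
destruct (Nat.eqb_spec i M) as [E1|E1]; [|destruct (Nat.eqb_spec i (M + 1)) as [E2|E2]].
- subst i. simpl (true || _)%bool. cbv iota.
  rewrite (proj2 (Nat.ltb_lt (M - 1) M)) by lia.
  rewrite Nat.ltb_irrefl, (proj2 (Nat.leb_le M M)) by lia.
  rewrite (proj2 (Nat.leb_le (M - 1) M)) by lia.
  rewrite (proj2 (Nat.leb_gt (M + 1) M)) by lia.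
  rewrite plus_INR. simpl (INR 1).
  replace (km * (3 - (3 + 3) / 2)) with 0 by field.
  match goal with |- _ <= 0 + ?X + _ => replace X with (h M) by (field; lra) end.
  lra.
- subst i. simpl (false || true)%bool. cbv iota.
  replace (M + 1 - 1)%nat with M by lia.
  rewrite Nat.ltb_irrefl, Nat.eqb_refl.
  rewrite (proj2 (Nat.ltb_ge (M + 1) M)) by lia.
  rewrite (proj2 (Nat.leb_le M M)) by lia.
  rewrite (proj2 (Nat.leb_gt (M + 1) M)) by lia.
  rewrite (proj2 (Nat.leb_gt (M + 1 + 1) M)) by lia.
  rewrite !plus_INR. simpl (INR 1).
  match goal with |- _ <= ?X + ?Y + _ =>
    replace (X + Y) with (h M) by (field; lra) end.
  lra.
- simpl (false || false)%bool. cbv iota.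
  rewrite Rplus_0_r. eapply Rle_trans; [exact H3|].
  apply Req_le.
  destruct (Nat.lt_ge_cases i M) as [L|L].
  + rewrite (proj2 (Nat.ltb_lt (i - 1) M)) by lia.
    rewrite (proj2 (Nat.ltb_lt i M)) by lia.
    rewrite (proj2 (Nat.leb_le i M)) by lia.
    rewrite (proj2 (Nat.leb_le (i - 1) M)) by lia.
    rewrite (proj2 (Nat.leb_le (i + 1) M)) by lia.
    field.
  + rewrite (proj2 (Nat.ltb_ge (i - 1) M)) by lia.
    rewrite (proj2 (Nat.ltb_ge i M)) by lia.
    rewrite (proj2 (Nat.eqb_neq (i - 1) M)) by lia.
    rewrite (proj2 (Nat.leb_gt i M)) by lia.
    rewrite (proj2 (Nat.leb_gt (i - 1) M)) by lia.
    rewrite (proj2 (Nat.leb_gt (i + 1) M)) by lia.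
    rewrite plus_INR, minus_INR by lia. simpl (INR 1). field. lra.
Qed.

(** A residual of size [h] is tolerated on the two interface columns, instead of
    [h ^ 2], since the kink of the barrier sits there. *)
Lemma discrete_stability (km ks A : R) (M : nat) (F : nat -> nat -> R) :
  (1 <= M)%nat -> 1 <= km -> 1 <= ks -> 0 <= A ->
  (forall i j, (1 <= i <= N M - 1)%nat -> (1 <= j <= N M - 1)%nat ->
     Rabs (Lh km ks M F i j)
       <= A * (h M ^ 2
           + (if ((i =? M) || (i =? M + 1))%nat%bool then h M else 0))) ->
  (forall i j, (i <= N M)%nat -> (j <= N M)%nat -> on_boundary M i j ->
     Rabs (F i j) <= A) ->
  forall i j, (i <= N M)%nat -> (j <= N M)%nat -> Rabs (F i j) <= 3 * A.
Proof.
intros HM Hk Hs HA HL HB i j Hi Hj.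
assert (Hlin : forall s k l, (1 <= k)%nat ->
  Lh km ks M (fun i j => A * barrier ks M i + s * F i j) k l
  = A * Lh km ks M (fun i _ => barrier ks M i) k l + s * Lh km ks M F k l).
{ intros s k l H1. rewrite !Lh_edge by exact H1. field. }
(* Both signs of [F] are compared with [A] times the barrier. *)
assert (Hpos : forall s, s = 1 \/ s = -1 ->
  0 <= A * barrier ks M i + s * F i j).
{ intros s Es.
  apply (discrete_minimum_principle km ks M
    (fun i j => A * barrier ks M i + s * F i j)); trivial; try lra.
  - intros k l H1 H2. rewrite Hlin by lia.
    assert (L := Lh_barrier km ks M k l HM Hs H1).
    apply (Rmult_le_compat_l A) in L; [|exact HA].
    assert (L' := HL k l H1 H2). apply Rabs_le_between in L'.
    destruct Es as [-> | ->]; lra.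
  - intros k l H1 H2 Hb. assert (L := HB k l H1 H2 Hb).
    apply Rabs_le_between in L.
    assert (B := barrier_bounds ks M k HM Hs H1).
    assert (A <= A * barrier ks M k) by nra.
    destruct Es as [-> | ->]; lra. }
assert (P := Hpos 1 (or_introl eq_refl)).
assert (Q := Hpos (-1) (or_intror eq_refl)).
assert (B := barrier_bounds ks M i HM Hs Hi).
assert (A * barrier ks M i <= 3 * A) by nra.
apply Rabs_le_between. lra.
Qed.

Definition corrector (omega : nat -> R) (M i j : nat) : R :=
  if (i <=? M)%nat then omega j else 0.

(** Besides second differences of [omega], the corrector leaves [ks * omega] on
    the column [M] and [- ks * omega] on the column [M + 1]: the pattern that
    an error on the flux across the interface creates. *)
Lemma Lh_corrector (km ks : R) (M : nat) (omega : nat -> R) (i j : nat) :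
  (1 <= M)%nat -> (1 <= i)%nat ->
  Lh km ks M (corrector omega M) i j =
    if (i <=? M - 1)%nat then
      h M ^ 2 * omega j
      - km * (omega (j - 1)%nat + omega (j + 1)%nat - 2 * omega j)
    else if (i =? M)%nat then
      (ks + h M ^ 2) * omega j
      - km / 2 * (omega (j - 1)%nat + omega (j + 1)%nat - 2 * omega j)
    else if (i =? M + 1)%nat then
      - ks * omega j
      - ks / 2 * (omega (j - 1)%nat + omega (j + 1)%nat - 2 * omega j)
    else 0.
Proof.
intros HM Hi. rewrite Lh_edge by exact Hi. unfold edge, corrector.
destruct (Nat.ltb_spec i M); destruct (Nat.ltb_spec (i - 1) M);
destruct (Nat.eqb_spec i M); destruct (Nat.eqb_spec (i - 1) M);
destruct (Nat.eqb_spec i (M + 1));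
destruct (Nat.leb_spec i M); destruct (Nat.leb_spec (i - 1) M);
destruct (Nat.leb_spec (i + 1) M); destruct (Nat.leb_spec i (M - 1));
try lia; field.
Qed.

(** Convergence of order [r] from truncation errors that match the residual of
    the corrector on the two interface columns. *)
Lemma corrected_convergence (km ks A r : R) (M : nat) (f : R -> R -> R)
    (U v : nat -> nat -> R) (omega : nat -> R) :
  (1 <= M)%nat -> 1 <= km -> 1 <= ks <= km -> 0 <= A -> 0 <= r ->
  discrete_solution km ks f M v ->
  (forall i j, (i <= N M)%nat -> (j <= N M)%nat -> on_boundary M i j ->
     U i j = 0) ->
  (forall j, (j <= N M)%nat -> Rabs (omega j) <= A * r) ->
  (forall j, (1 <= j <= N M - 1)%nat ->
     Rabs (omega (j - 1)%nat + omega (j + 1)%nat - 2 * omega j)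
       <= A * r * h M ^ 2) ->
  (forall i j, (1 <= i <= N M - 1)%nat -> (1 <= j <= N M - 1)%nat ->
     i <> M -> i <> (M + 1)%nat ->
     Rabs (Lh km ks M U i j - h M ^ 2 * f (node M i) (node M j))
       <= A * r * h M ^ 2) ->
  (forall j, (1 <= j <= N M - 1)%nat ->
     Rabs (Lh km ks M U M j - h M ^ 2 * f (node M M) (node M j) - ks * omega j)
       <= A * r * h M) ->
  (forall j, (1 <= j <= N M - 1)%nat ->
     Rabs (Lh km ks M U (M + 1) j
           - h M ^ 2 * f (node M (M + 1)) (node M j) + ks * omega j)
       <= A * r * h M) ->
  forall i j, (i <= N M)%nat -> (j <= N M)%nat ->
  Rabs (U i j - v i j) <= (3 * (km + 2) + 1) * (A * r).
Proof.
intros HM Hk Hs HA Hr [Hv Hv0] HU Hw Hdw HT HTM HTM1 i j Hi Hj.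
assert (Hh := h_bounds M HM).
assert (HAr : 0 <= A * r) by (now apply Rmult_le_pos).
assert (HNM : N M = (2 * M + 1)%nat) by reflexivity.
(* Stability is applied to the error after subtraction of the corrector. *)
set (E := fun i j => U i j - corrector omega M i j - v i j).
assert (Hlin : forall k l, (1 <= k <= N M - 1)%nat -> (1 <= l <= N M - 1)%nat ->
  Lh km ks M E k l = Lh km ks M U k l - h M ^ 2 * f (node M k) (node M l)
    - Lh km ks M (corrector omega M) k l).
{ intros k l H1 H2. rewrite <- (Hv k l H1 H2).
  rewrite !Lh_edge by lia. unfold E. field. }
assert (Hcor : forall k l, (l <= N M)%nat ->
  Rabs (corrector omega M k l) <= A * r).
{ intros k l Hl. unfold corrector. destruct (k <=? M)%nat; [now apply Hw|].
  now rewrite Rabs_R0. }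
assert (HE : forall k l, (k <= N M)%nat -> (l <= N M)%nat ->
  Rabs (E k l) <= 3 * ((km + 2) * (A * r))).
{ apply (discrete_stability km ks); trivial; try lra.
  - apply Rmult_le_pos; lra.
  - intros k l H1 H2. rewrite Hlin, Lh_corrector by lia.
    assert (Wl := Hw l ltac:(lia)). assert (Dl := Hdw l H2).
    assert (H2pos : 0 <= h M ^ 2) by (apply pow2_ge_0).
    assert (W2 : Rabs (h M ^ 2 * omega l) <= A * r * h M ^ 2).
    { rewrite Rabs_mult, (Rabs_pos_eq (h M ^ 2)) by exact H2pos. nra. }
    assert (DD : forall c, 0 <= c <= km ->
      Rabs (c * (omega (l - 1)%nat + omega (l + 1)%nat - 2 * omega l))
        <= km * (A * r * h M ^ 2)).
    { intros c Hc. rewrite Rabs_mult, (Rabs_pos_eq c) by apply Hc.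
      apply Rmult_le_compat; trivial; try apply Rabs_pos; apply Hc. }
    assert (Q : 0 <= A * r * h M ^ 2) by (now apply Rmult_le_pos).
    assert (Qh : 0 <= A * r * h M) by (apply Rmult_le_pos; lra).
    assert (Qk : 0 <= km * (A * r * h M)) by (apply Rmult_le_pos; lra).
    destruct (Nat.leb_spec k (M - 1)) as [L1|L1];
      [|destruct (Nat.eqb_spec k M) as [->|N1];
        [|destruct (Nat.eqb_spec k (M + 1)) as [->|N2]]].
    + rewrite (proj2 (Nat.eqb_neq k M)) by lia.
      rewrite (proj2 (Nat.eqb_neq k (M + 1))) by lia. cbn [orb].
      assert (TT := HT k l H1 H2 ltac:(lia) ltac:(lia)).
      specialize (DD km ltac:(lra)).
      apply Rabs_le_between in TT, DD, W2. apply Rabs_le_between. lra.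
    + cbn [orb]. assert (TT := HTM l H2).
      specialize (DD (km / 2) ltac:(lra)).
      apply Rabs_le_between in TT, DD, W2. apply Rabs_le_between. lra.
    + cbn [orb]. assert (TT := HTM1 l H2).
      specialize (DD (ks / 2) ltac:(lra)).
      apply Rabs_le_between in TT, DD. apply Rabs_le_between. lra.
    + cbn [orb].
      assert (TT := HT k l H1 H2 N1 N2).
      assert (Qk2 : 0 <= km * (A * r * h M ^ 2)) by (apply Rmult_le_pos; lra).
      apply Rabs_le_between in TT. apply Rabs_le_between. lra.
  - intros k l H1 H2 Hb. unfold E. rewrite (HU k l H1 H2 Hb).
    assert (Hvb : v k l = 0).
    { destruct Hb as [-> | [-> | [-> | ->]]];
      [apply (Hv0 l H2)|apply (Hv0 l H2)|apply (Hv0 k H1)|apply (Hv0 k H1)]. }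
    rewrite Hvb. assert (W := Hcor k l H2).
    assert (0 <= km * (A * r)) by (apply Rmult_le_pos; lra).
    apply Rabs_le_between in W. apply Rabs_le_between. lra. }
assert (H1 := HE i j Hi Hj). assert (H2 := Hcor i j Hj).
unfold E in H1. apply Rabs_le_between in H1, H2. apply Rabs_le_between. lra.
Qed.

(** * The interface problem in terms of extended derivatives *)

Lemma closed_jet_weaken (a b K K' : R) (G : nat -> nat -> R -> R -> R) :
  K <= K' -> closed_jet a b K G -> closed_jet a b K' G.
Proof.
intros HK [Hc [HB HD]]. split; [exact Hc|split; [|exact HD]].
intros m n x y L H. eapply Rle_trans; [now apply HB|exact HK].
Qed.

Lemma jet_lipschitz_x (a b K : R) (G : nat -> nat -> R -> R -> R) (m n : nat) :
  a < b -> closed_jet a b K G -> (m + n <= 3)%nat ->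
  forall x x' y, rect_bar a b (x, y) -> rect_bar a b (x', y) ->
  Rabs (G m n x' y - G m n x y) <= K * Rabs (x' - x).
Proof.
intros Hab HG Hmn x x' y Hx Hx'.
assert (T := jet_taylor_x a b K G m n 1 Hab HG ltac:(lia) x x' y Hx Hx').
simpl in T. rewrite Rmult_1_r in T.
replace (0 + G m n x y * (1 / 1)) with (G m n x y) in T by field. exact T.
Qed.

Lemma jet_quadratic_x (a b K : R) (G : nat -> nat -> R -> R -> R) :
  a < b -> closed_jet a b K G ->
  forall x x' y, rect_bar a b (x, y) -> rect_bar a b (x', y) ->
  Rabs (G 0%nat 0%nat x' y
        - (G 0%nat 0%nat x y + (x' - x) * G 1%nat 0%nat x y
           + (x' - x) ^ 2 / 2 * G 2%nat 0%nat x y))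
    <= K * Rabs (x' - x) ^ 3.
Proof.
intros Hab HG x x' y Hx Hx'.
assert (T := jet_taylor_x a b K G 0 0 3 Hab HG ltac:(lia) x x' y Hx Hx').
simpl taylor_poly in T.
match type of T with Rabs (?A - ?B) <= _ =>
  match goal with |- Rabs (_ - ?D) <= _ => replace D with B by field end end.
exact T.
Qed.

Lemma exact_solution_left (km : R) (f u : R -> R -> R) (x y : R) :
  exact_solution km f u -> rect 0 (1 / 2) (x, y) ->
  f x y = u x y - km * (partial_derive 2 0 u x y + partial_derive 0 2 u x y).
Proof.
intros [Hpde _] Hxy. rewrite <- (Hpde x y (or_introl Hxy)).
destruct Hxy as [Hx Hy]. simpl in Hx, Hy. unfold div_kappa_grad.
rewrite (Derive_ext_loc _ (fun s => km * Derive (fun t => u t y) s)).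
2:{ generalize (locally_open_interval 0 (1 / 2) x Hx). apply filter_imp.
    intros s Hs. unfold kappa. destruct (Rlt_dec s (1 / 2)); [reflexivity|lra]. }
rewrite !Derive_scal. unfold kappa. destruct (Rlt_dec x (1 / 2)); [|lra].
change (partial_derive 2 0 u x y) with (Derive (Derive (fun t => u t y)) x).
change (partial_derive 0 2 u x y) with (Derive (Derive (fun t => u x t)) y).
change (Derive (fun s => Derive (fun t => u t y) s) x)
  with (Derive (Derive (fun t => u t y)) x).
change (Derive (fun s => Derive (fun t => u x t) s) y)
  with (Derive (Derive (fun t => u x t)) y).
ring.
Qed.

Lemma exact_solution_right (km : R) (f u : R -> R -> R) (x y : R) :
  exact_solution km f u -> rect (1 / 2) 1 (x, y) ->
  f x y = u x y - 1 * (partial_derive 2 0 u x y + partial_derive 0 2 u x y).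
Proof.
intros [Hpde _] Hxy. rewrite <- (Hpde x y (or_intror Hxy)).
destruct Hxy as [Hx Hy]. simpl in Hx, Hy. unfold div_kappa_grad.
rewrite (Derive_ext_loc _ (fun s => 1 * Derive (fun t => u t y) s)).
2:{ generalize (locally_open_interval (1 / 2) 1 x Hx). apply filter_imp.
    intros s Hs. unfold kappa. destruct (Rlt_dec s (1 / 2)); [lra|reflexivity]. }
rewrite !Derive_scal. unfold kappa. destruct (Rlt_dec x (1 / 2)); [lra|].
change (partial_derive 2 0 u x y) with (Derive (Derive (fun t => u t y)) x).
change (partial_derive 0 2 u x y) with (Derive (Derive (fun t => u x t)) y).
change (Derive (fun s => Derive (fun t => u t y) s) x)
  with (Derive (Derive (fun t => u t y)) x).
change (Derive (fun s => Derive (fun t => u x t) s) y)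
  with (Derive (Derive (fun t => u x t)) y).
ring.
Qed.

Lemma trace_left (g : R -> R -> R) (y : R) :
  continuous_on_set (rect_bar 0 (1 / 2)) g -> 0 < y < 1 ->
  filterlim (fun x => g x y) (at_left (1 / 2)) (locally (g (1 / 2) y)).
Proof.
intros Hg Hy.
apply (filterlim_comp _ _ _ (fun x => (x, y)) (fun p : R * R => g (fst p) (snd p))
  _ (within (rect_bar 0 (1 / 2)) (locally (1 / 2, y)))).
2:{ apply Hg. split; simpl; lra. }
intros P [eps HP]. unfold filtermap, at_left, within.
apply (filter_imp (fun x : R => ball (1 / 2) eps x /\ 0 < x)).
- intros x [Hx H0] Hlt. apply HP; [|split; simpl; lra].
  split; [exact Hx|apply ball_center].
- apply filter_and; [apply locally_ball|apply open_gt; lra].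
Qed.

Lemma trace_right (g : R -> R -> R) (y : R) :
  continuous_on_set (rect_bar (1 / 2) 1) g -> 0 < y < 1 ->
  filterlim (fun x => g x y) (at_right (1 / 2)) (locally (g (1 / 2) y)).
Proof.
intros Hg Hy.
apply (filterlim_comp _ _ _ (fun x => (x, y)) (fun p : R * R => g (fst p) (snd p))
  _ (within (rect_bar (1 / 2) 1) (locally (1 / 2, y)))).
2:{ apply Hg. split; simpl; lra. }
intros P [eps HP]. unfold filtermap, at_right, within.
apply (filter_imp (fun x : R => ball (1 / 2) eps x /\ x < 1)).
- intros x [Hx H0] Hlt. apply HP; [|split; simpl; lra].
  split; [exact Hx|apply ball_center].
- apply filter_and; [apply locally_ball|apply open_lt; lra].
Qed.

Lemma near_left (P : R -> Prop) :
  (forall x, 0 < x < 1 / 2 -> P x) -> at_left (1 / 2) P.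
Proof.
intros HP. unfold at_left, within.
apply (filter_imp (fun x : R => 0 < x)); [|apply open_gt; lra].
intros x Hx Hlt. apply HP. lra.
Qed.

Lemma near_right (P : R -> Prop) :
  (forall x, 1 / 2 < x < 1 -> P x) -> at_right (1 / 2) P.
Proof.
intros HP. unfold at_right, within.
apply (filter_imp (fun x : R => x < 1)); [|apply open_lt; lra].
intros x Hx Hlt. apply HP. lra.
Qed.

(** The jump condition bears on one-sided limits, which are the traces of the
    extended derivatives. *)
Lemma flux_continuity (km K : R) (f u : R -> R -> R)
    (GL GR : nat -> nat -> R -> R -> R) (y : R) :
  exact_solution km f u ->
  closed_jet 0 (1 / 2) K GL -> closed_jet (1 / 2) 1 K GR ->
  (forall x y, rect 0 (1 / 2) (x, y) ->
     GL 1%nat 0%nat x y = partial_derive 1 0 u x y) ->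
  (forall x y, rect (1 / 2) 1 (x, y) ->
     GR 1%nat 0%nat x y = partial_derive 1 0 u x y) ->
  0 < y < 1 ->
  km * GL 1%nat 0%nat (1 / 2) y = GR 1%nat 0%nat (1 / 2) y.
Proof.
intros [_ [_ [_ Hflux]]] [HcL _] [HcR _] EL ER Hy.
destruct (Hflux y Hy) as [l [Hl Hr]].
transitivity l.
- apply (filterlim_locally_unique (F := at_left (1 / 2))
    (fun x => km * GL 1%nat 0%nat x y)).
  + assert (T := trace_left _ y (HcL 1%nat 0%nat ltac:(lia)) Hy).
    exact (filterlim_comp _ _ _ _ (fun z : R => km * z) _ _ _ T
      (filterlim_scal_r km (GL 1%nat 0%nat (1 / 2) y))).
  + apply (filterlim_ext_loc (fun x => kappa km x * Derive (fun t => u t y) x));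
      [|exact Hl].
    apply near_left. intros x Hx. rewrite EL by (split; assumption).
    unfold kappa. destruct (Rlt_dec x (1 / 2)); [reflexivity|lra].
- symmetry.
  apply (filterlim_locally_unique (F := at_right (1 / 2))
    (fun x => GR 1%nat 0%nat x y)).
  + exact (trace_right _ y (HcR 1%nat 0%nat ltac:(lia)) Hy).
  + apply (filterlim_ext_loc (fun x => kappa km x * Derive (fun t => u t y) x));
      [|exact Hr].
    apply near_right. intros x Hx. rewrite ER by (split; assumption).
    unfold kappa. destruct (Rlt_dec x (1 / 2)); [lra|apply Rmult_1_l].
Qed.

Lemma Rabs_mult_le (k km s A : R) :
  0 <= k <= km -> Rabs s <= A -> Rabs (k * s) <= km * A.
Proof.
intros Hk Hs. rewrite Rabs_mult, (Rabs_pos_eq k) by apply Hk.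
apply Rmult_le_compat; trivial; try apply Hk. apply Rabs_pos.
Qed.

(** Pure arithmetic of the truncation error at one of the interface columns.
    [p], [c], [P] are the traces of [u], [u_xx] and [u_yy] at the interface and
    [a] that of the derivative along the normal pointing to the opposite side;
    primes and [b] refer to that side. The nodal values are [u1] and [u2] in the
    near and the far column of the own side, [o1] in the near column of the other,
    with suffixes [d] and [u] for the neighbours below and above. All remainders
    are of order [d ^ 3]. *)
Lemma interface_expansion (alpha ks km d K p a b c c' P P'
    u1 u2 u2d u2u o1 od ou c1 P1 P2 Po : R) :
  0 <= alpha <= km -> 0 <= ks <= km -> 0 <= d <= 1 -> 0 <= K ->
  Rabs (u1 - (p - d / 2 * a + d ^ 2 / 8 * c)) <= K * (d / 2) ^ 3 ->
  Rabs (u2 - (p - 3 * d / 2 * a + 9 * d ^ 2 / 8 * c)) <= K * (3 * d / 2) ^ 3 ->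
  Rabs (o1 - (p + d / 2 * b + d ^ 2 / 8 * c')) <= K * (d / 2) ^ 3 ->
  Rabs (u2d + u2u - 2 * u2 - d ^ 2 * P2) <= 2 * K * d ^ 4 ->
  Rabs (od + ou - 2 * o1 - d ^ 2 * Po) <= 2 * K * d ^ 4 ->
  Rabs (c1 - c) <= K * (d / 2) ->
  Rabs (P1 - P) <= K * (d / 2) ->
  Rabs (P2 - P) <= K * (3 * d / 2) ->
  Rabs (Po - P') <= K * (d / 2) ->
  Rabs (alpha * (u1 - (u2d + u2u) / 2) + ks * (u1 - (od + ou) / 2)
        + alpha * d ^ 2 * (c1 + P1)
        - (d * (alpha * a - ks * (a + b) / 2) + d ^ 2 * (ks * (c - c')) / 8
           + d ^ 2 * (alpha * P - ks * P') / 2))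
    <= 8 * km * K * d ^ 3.
Proof.
intros Ha Hs Hd HK H1 H2 H3 H4 H5 H6 H7 H8 H9.
set (R1 := u1 - _) in H1. set (R2 := u2 - _) in H2. set (R3 := o1 - _) in H3.
set (R4 := u2d + u2u - _ - _) in H4. set (R5 := od + ou - _ - _) in H5.
(* The nine remainders are bounded by multiples of this common unit. *)
set (e := K * d ^ 3).
assert (Hd3 : 0 <= d ^ 3) by (apply pow_le; lra).
assert (He : 0 <= e) by (now apply Rmult_le_pos).
replace (K * (d / 2) ^ 3) with (e / 8) in H1, H3 by (unfold e; field).
replace (K * (3 * d / 2) ^ 3) with (27 * e / 8) in H2 by (unfold e; field).
assert (Hd4 : 2 * K * d ^ 4 <= 2 * e).
{ replace (2 * K * d ^ 4) with (2 * e * d) by (unfold e; ring). nra. }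
assert (Hd2 : 0 <= d ^ 2 <= d ^ 2) by (split; [apply pow2_ge_0|lra]).
apply (Rabs_mult_le _ _ _ _ Hd2) in H6, H7, H8, H9.
replace (d ^ 2 * (K * (d / 2))) with (e / 2) in H6, H7, H9 by (unfold e; field).
replace (d ^ 2 * (K * (3 * d / 2))) with (3 * e / 2) in H8 by (unfold e; field).
assert (S1 : Rabs (R1 - R2 - d ^ 2 * (P2 - P) / 2 - R4 / 2
                   + d ^ 2 * (c1 - c) + d ^ 2 * (P1 - P)) <= 25 / 4 * e).
{ apply Rabs_le_between in H1, H2, H4, H6, H7, H8. apply Rabs_le_between. lra. }
assert (S2 : Rabs (R1 - R3 - R5 / 2 - d ^ 2 * (Po - P') / 2) <= 3 / 2 * e).
{ apply Rabs_le_between in H1, H3, H5, H9. apply Rabs_le_between. lra. }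
apply (Rabs_mult_le _ _ _ _ Ha) in S1. apply (Rabs_mult_le _ _ _ _ Hs) in S2.
match goal with |- Rabs ?X <= _ => replace X with
  (alpha * (R1 - R2 - d ^ 2 * (P2 - P) / 2 - R4 / 2
            + d ^ 2 * (c1 - c) + d ^ 2 * (P1 - P))
   + ks * (R1 - R3 - R5 / 2 - d ^ 2 * (Po - P') / 2))
  by (unfold R1, R2, R3, R4, R5; field) end.
replace (8 * km * K * d ^ 3) with (8 * (km * e)) by (unfold e; ring).
assert (0 <= km * e) by (apply Rmult_le_pos; lra).
eapply Rle_trans; [apply Rabs_triang|]. lra.
Qed.

(** * Truncation errors and convergence *)

Lemma node_S (M i : nat) : node M (i + 1) = node M i + h M.
Proof. unfold node. rewrite plus_INR. simpl. ring. Qed.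

Lemma node_pred (M i : nat) : (1 <= i)%nat -> node M (i - 1) = node M i - h M.
Proof.
intros Hi. unfold node. rewrite minus_INR by exact Hi. simpl. ring.
Qed.

Lemma node_M (M : nat) : node M M = 1 / 2 - h M / 2.
Proof. unfold node. assert (E := h_times_N M). lra. Qed.

Lemma node_le (M i j : nat) : (1 <= M)%nat -> (i <= j)%nat -> node M i <= node M j.
Proof.
intros HM Hij. assert (Hh := h_bounds M HM). unfold node.
apply Rmult_le_compat_r; [lra|now apply le_INR].
Qed.

Lemma node_0 (M : nat) : node M 0 = 0.
Proof. unfold node. simpl. ring. Qed.

Lemma node_N (M : nat) : node M (N M) = 1.
Proof.
unfold node, N. rewrite plus_INR, mult_INR. simpl. assert (E := h_times_N M). lra.
Qed.

Lemma node_bounds (M j : nat) : (1 <= M)%nat -> (j <= N M)%nat -> 0 <= node M j <= 1.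
Proof.
intros HM Hj. rewrite <- (node_0 M) at 1. rewrite <- (node_N M).
split; apply node_le; trivial; lia.
Qed.

Lemma node_bounds_strict (M j : nat) :
  (1 <= M)%nat -> (1 <= j <= N M - 1)%nat -> 0 < node M j < 1.
Proof.
intros HM Hj. assert (Hh := h_bounds M HM).
assert (A := node_bounds M (j - 1) HM ltac:(lia)).
assert (B := node_bounds M (j + 1) HM ltac:(lia)).
rewrite node_pred in A by lia. rewrite node_S in B. lra.
Qed.

(** All that the truncation analysis uses of the exact solution. *)
Definition interface_jets (km K : R) (f u : R -> R -> R)
    (GL GR : nat -> nat -> R -> R -> R) : Prop :=
  (closed_jet 0 (1 / 2) K GL /\ closed_jet (1 / 2) 1 K GR) /\
  (forall x y, GL 0%nat 0%nat x y = u x y) /\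
  (forall x y, GR 0%nat 0%nat x y = u x y) /\
  (forall x y, rect 0 (1 / 2) (x, y) ->
     f x y = u x y - km * (GL 2%nat 0%nat x y + GL 0%nat 2%nat x y)) /\
  (forall x y, rect (1 / 2) 1 (x, y) ->
     f x y = u x y - 1 * (GR 2%nat 0%nat x y + GR 0%nat 2%nat x y)) /\
  (forall y, 0 < y < 1 ->
     km * GL 1%nat 0%nat (1 / 2) y = GR 1%nat 0%nat (1 / 2) y).

Definition nodal (M : nat) (u : R -> R -> R) (i j : nat) : R :=
  u (node M i) (node M j).

(** The interval [[a, b]] is that of either subdomain, with coefficient [kap]. *)
Lemma truncation_inside_subdomain (a b kap km ks K : R) (f u : R -> R -> R)
    (G : nat -> nat -> R -> R -> R) (M i j : nat) :
  (1 <= M)%nat -> a < b -> 0 <= kap <= km -> closed_jet a b K G ->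
  (forall x y, G 0%nat 0%nat x y = u x y) ->
  f (node M i) (node M j) = u (node M i) (node M j)
    - kap * (G 2%nat 0%nat (node M i) (node M j)
             + G 0%nat 2%nat (node M i) (node M j)) ->
  (1 <= i)%nat -> (1 <= j <= N M - 1)%nat ->
  a <= node M (i - 1) -> node M (i + 1) <= b ->
  edge km ks M (i - 1) = kap -> edge km ks M i = kap ->
  Rabs (Lh km ks M (nodal M u) i j - h M ^ 2 * f (node M i) (node M j))
    <= 6 * km * K * h M ^ 4.
Proof.
intros HM Hab Hkap HG EG Ef Hi Hj Ha Hb E1 E2.
assert (Hh := h_bounds M HM).
assert (Jm := node_bounds M (j - 1) HM ltac:(lia)).
assert (J0 := node_bounds M j HM ltac:(lia)).
assert (Jp := node_bounds M (j + 1) HM ltac:(lia)).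
assert (D := jet_diagonal_laplacian a b K G Hab HG
  (node M (i - 1)) (node M i) (node M (i + 1))
  (node M (j - 1)) (node M j) (node M (j + 1)) (h M)).
rewrite !EG in D.
rewrite Lh_edge by exact Hi. rewrite E1, E2, Ef. unfold nodal.
rewrite !node_S, !node_pred in * by lia.
specialize (D ltac:(lra) ltac:(lra) ltac:(lra) Jm J0 Jp
  ltac:(lra) ltac:(lra) ltac:(lra) ltac:(lra)).
match type of D with Rabs ?X <= _ =>
  match goal with |- Rabs ?Y <= _ => replace Y with (kap * (- X / 2)) by field end end.
replace (6 * km * K * h M ^ 4) with (km * (12 * K * h M ^ 4 / 2)) by field.
apply Rabs_mult_le; [exact Hkap|].
apply Rabs_le_between in D. apply Rabs_le_between. lra.
Qed.

(** Both interface columns are treated at once: [G] belongs to the side of the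
    column considered and [G'] to the opposite one, and the reflection
    [sigma = -1] exchanges the roles of left and right, which changes the sign of
    the normal derivatives only. *)
Lemma truncation_at_interface (sigma alpha ks km d K a b a' b' y0 y1 y2 : R)
    (u : R -> R -> R) (G G' : nat -> nat -> R -> R -> R) :
  sigma = 1 \/ sigma = -1 ->
  0 <= alpha <= km -> 0 <= ks <= km -> 0 <= d <= 1 ->
  a < b -> a' < b' -> closed_jet a b K G -> closed_jet a' b' K G' ->
  (forall x y, G 0%nat 0%nat x y = u x y) ->
  (forall x y, G' 0%nat 0%nat x y = u x y) ->
  a <= 1 / 2 <= b -> a' <= 1 / 2 <= b' ->
  a <= 1 / 2 - sigma * (d / 2) <= b ->
  a <= 1 / 2 - sigma * (3 * d / 2) <= b ->
  a' <= 1 / 2 + sigma * (d / 2) <= b' ->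
  0 <= y0 <= 1 -> 0 <= y1 <= 1 -> 0 <= y2 <= 1 ->
  y1 - y0 = d -> y2 - y1 = d ->
  forall near far opp,
  near = 1 / 2 - sigma * (d / 2) ->
  far = 1 / 2 - sigma * (3 * d / 2) ->
  opp = 1 / 2 + sigma * (d / 2) ->
  Rabs (alpha * (u near y1 - (u far y0 + u far y2) / 2)
        + ks * (u near y1 - (u opp y0 + u opp y2) / 2)
        + alpha * d ^ 2 * (G 2%nat 0%nat near y1 + G 0%nat 2%nat near y1)
        - (d * (alpha * (sigma * G 1%nat 0%nat (1 / 2) y1)
                - ks * (sigma * G 1%nat 0%nat (1 / 2) y1
                        + sigma * G' 1%nat 0%nat (1 / 2) y1) / 2)
           + d ^ 2 * (ks * (G 2%nat 0%nat (1 / 2) y1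
                            - G' 2%nat 0%nat (1 / 2) y1)) / 8
           + d ^ 2 * (alpha * G 0%nat 2%nat (1 / 2) y1
                      - ks * G' 0%nat 2%nat (1 / 2) y1) / 2))
    <= 8 * km * K * d ^ 3.
Proof.
intros Hsig Ha Hs Hd Hab Hab' HG HG' EG EG' H12 H12' Bn Bf Bo Y0 Y1 Y2 E1 E2
  near far opp En Ef Eo.
rewrite <- En in Bn. rewrite <- Ef in Bf. rewrite <- Eo in Bo.
assert (HK := jet_bound_nonneg a b K G Hab HG).
assert (Hsig2 : sigma ^ 2 = 1) by (destruct Hsig as [-> | ->]; ring).
assert (An : Rabs (near - 1 / 2) = d / 2).
{ rewrite En. destruct Hsig as [-> | ->]; unfold Rabs; destruct (Rcase_abs _); lra. }
assert (Af : Rabs (far - 1 / 2) = 3 * d / 2).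
{ rewrite Ef. destruct Hsig as [-> | ->]; unfold Rabs; destruct (Rcase_abs _); lra. }
assert (Ao : Rabs (opp - 1 / 2) = d / 2).
{ rewrite Eo. destruct Hsig as [-> | ->]; unfold Rabs; destruct (Rcase_abs _); lra. }
assert (Rn : forall y, 0 <= y <= 1 -> rect_bar a b (near, y)) by (split; assumption).
assert (Rf : forall y, 0 <= y <= 1 -> rect_bar a b (far, y)) by (split; assumption).
assert (Rc : forall y, 0 <= y <= 1 -> rect_bar a b (1 / 2, y)) by (split; assumption).
assert (Ro : forall y, 0 <= y <= 1 -> rect_bar a' b' (opp, y)) by (split; assumption).
assert (Rc' : forall y, 0 <= y <= 1 -> rect_bar a' b' (1 / 2, y)) by (split; assumption).
assert (Q1 := jet_quadratic_x a b K G Hab HG (1 / 2) near y1 (Rc _ Y1) (Rn _ Y1)).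
assert (Q2 := jet_quadratic_x a b K G Hab HG (1 / 2) far y1 (Rc _ Y1) (Rf _ Y1)).
assert (Q3 := jet_quadratic_x a' b' K G' Hab' HG' (1 / 2) opp y1 (Rc' _ Y1) (Ro _ Y1)).
assert (Q4 := jet_second_difference_taylor_y a b K G Hab HG far y0 y1 y2
  (Rf _ Y0) (Rf _ Y1) (Rf _ Y2) ltac:(lra)).
assert (Q5 := jet_second_difference_taylor_y a' b' K G' Hab' HG' opp y0 y1 y2
  (Ro _ Y0) (Ro _ Y1) (Ro _ Y2) ltac:(lra)).
assert (Q6 := jet_lipschitz_x a b K G 2 0 Hab HG ltac:(lia) (1 / 2) near y1
  (Rc _ Y1) (Rn _ Y1)).
assert (Q7 := jet_lipschitz_x a b K G 0 2 Hab HG ltac:(lia) (1 / 2) near y1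
  (Rc _ Y1) (Rn _ Y1)).
assert (Q8 := jet_lipschitz_x a b K G 0 2 Hab HG ltac:(lia) (1 / 2) far y1
  (Rc _ Y1) (Rf _ Y1)).
assert (Q9 := jet_lipschitz_x a' b' K G' 0 2 Hab' HG' ltac:(lia) (1 / 2) opp y1
  (Rc' _ Y1) (Ro _ Y1)).
rewrite An in Q1, Q6, Q7. rewrite Af in Q2, Q8. rewrite Ao in Q3, Q9.
rewrite E2 in Q4, Q5. rewrite !EG in Q1, Q2. rewrite !EG' in Q3.
rewrite !EG in Q4. rewrite !EG' in Q5.
apply (interface_expansion alpha ks km d K (u (1 / 2) y1)
  (sigma * G 1%nat 0%nat (1 / 2) y1) (sigma * G' 1%nat 0%nat (1 / 2) y1)
  (G 2%nat 0%nat (1 / 2) y1) (G' 2%nat 0%nat (1 / 2) y1)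
  (G 0%nat 2%nat (1 / 2) y1) (G' 0%nat 2%nat (1 / 2) y1)
  (u near y1) (u far y1) (u far y0) (u far y2)
  (u opp y1) (u opp y0) (u opp y2) (G 2%nat 0%nat near y1) (G 0%nat 2%nat near y1)
  (G 0%nat 2%nat far y1) (G' 0%nat 2%nat opp y1)); trivial.
- replace (near - 1 / 2) with (- sigma * (d / 2)) in Q1 by (rewrite En; ring).
  replace ((- sigma * (d / 2)) ^ 2) with (sigma ^ 2 * (d / 2) ^ 2) in Q1 by ring.
  rewrite Hsig2 in Q1. eapply Rle_trans; [|exact Q1].
  apply Req_le, f_equal. field.
- replace (far - 1 / 2) with (- sigma * (3 * d / 2)) in Q2 by (rewrite Ef; ring).
  replace ((- sigma * (3 * d / 2)) ^ 2) with (sigma ^ 2 * (3 * d / 2) ^ 2) in Q2 by ring.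
  rewrite Hsig2 in Q2. eapply Rle_trans; [|exact Q2].
  apply Req_le, f_equal. field.
- replace (opp - 1 / 2) with (sigma * (d / 2)) in Q3 by (rewrite Eo; ring).
  replace ((sigma * (d / 2)) ^ 2) with (sigma ^ 2 * (d / 2) ^ 2) in Q3 by ring.
  rewrite Hsig2 in Q3. eapply Rle_trans; [|exact Q3].
  apply Req_le, f_equal. field.
Qed.

(** The average of the normal derivatives on the two sides is [(1 + km) / 2] times
    the left one, so that [ks] reproduces the flux exactly when this vanishes,
    that is, when [ks] is the harmonic average. *)
Definition coefficient_defect (km ks : R) : R := km - ks * (1 + km) / 2.

(** The error on the flux across the interface, divided by [ks]: a first order
    part from the choice of [ks], and a second order one from the jump of
    [u_xx]. *)
Definition interface_defect (km ks : R) (GL GR : nat -> nat -> R -> R -> R)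
    (d y : R) : R :=
  d * (coefficient_defect km ks / ks) * GL 1%nat 0%nat (1 / 2) y
  + d ^ 2 / 8 * (GL 2%nat 0%nat (1 / 2) y - GR 2%nat 0%nat (1 / 2) y).

Lemma tangential_term_bound (km alpha ks p p' P d : R) :
  0 <= alpha <= km -> 0 <= ks <= km -> Rabs p <= P -> Rabs p' <= P ->
  Rabs (d ^ 2 * (alpha * p - ks * p') / 2) <= km * P * d ^ 2.
Proof.
intros Ha Hs Hp Hp'.
apply (Rabs_mult_le _ _ _ _ Ha) in Hp. apply (Rabs_mult_le _ _ _ _ Hs) in Hp'.
assert (Hd : 0 <= d ^ 2 <= d ^ 2) by (split; [apply pow2_ge_0|lra]).
replace (d ^ 2 * (alpha * p - ks * p') / 2)
  with (d ^ 2 * ((alpha * p - ks * p') / 2)) by field.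
rewrite (Rmult_comm (km * P)). apply Rabs_mult_le; [exact Hd|].
apply Rabs_le_between in Hp, Hp'. apply Rabs_le_between. lra.
Qed.

(** Both columns are adjacent to the wrong flux, hence the opposite signs of the
    defect here and in [truncation_right_of_interface]. The tangential terms
    in [u_yy] do not cancel between the two columns, so they go to the
    remainder. *)
Lemma truncation_left_of_interface (km ks K P : R) (f u : R -> R -> R)
    (GL GR : nat -> nat -> R -> R -> R) (M j : nat) :
  1 <= km -> 1 <= ks <= km -> (1 <= M)%nat ->
  interface_jets km K f u GL GR ->
  (forall y, 0 < y < 1 -> Rabs (GL 0%nat 2%nat (1 / 2) y) <= P) ->
  (forall y, 0 < y < 1 -> Rabs (GR 0%nat 2%nat (1 / 2) y) <= P) ->
  (1 <= j <= N M - 1)%nat ->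
  Rabs (Lh km ks M (nodal M u) M j - h M ^ 2 * f (node M M) (node M j)
        - ks * interface_defect km ks GL GR (h M) (node M j))
    <= 8 * km * K * h M ^ 3 + km * P * h M ^ 2.
Proof.
intros Hkm Hks HM [[HL HR] [EL [ER [FL [FR Hflux]]]]] HPL HPR Hj.
assert (Hh := h_bounds M HM). assert (E := node_M M).
assert (Jm := node_bounds M (j - 1) HM ltac:(lia)).
assert (J0 := node_bounds_strict M j HM Hj).
assert (Jp := node_bounds M (j + 1) HM ltac:(lia)).
specialize (Hflux (node M j) J0).
assert (T := tangential_term_bound km km ks _ _ P (h M) ltac:(lra) ltac:(lra)
  (HPL _ J0) (HPR _ J0)).
assert (I := truncation_at_interface 1 km ks km (h M) K 0 (1 / 2) (1 / 2) 1
  (node M (j - 1)) (node M j) (node M (j + 1)) u GL GR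
  (or_introl eq_refl) ltac:(lra) ltac:(lra) ltac:(lra) ltac:(lra) ltac:(lra)
  HL HR EL ER ltac:(lra) ltac:(lra) ltac:(lra) ltac:(lra) ltac:(lra)
  ltac:(lra) ltac:(lra) ltac:(lra)).
specialize (I ltac:(rewrite node_pred by lia; lra) ltac:(rewrite node_S; lra)
  (node M M) (node M (M - 1)) (node M (M + 1))
  ltac:(lra) ltac:(rewrite node_pred by lia; lra) ltac:(rewrite node_S; lra)).
rewrite Lh_edge by exact HM.
replace (edge km ks M (M - 1)) with km.
2:{ unfold edge. now rewrite (proj2 (Nat.ltb_lt (M - 1) M)) by lia. }
replace (edge km ks M M) with ks.
2:{ unfold edge. now rewrite Nat.ltb_irrefl, Nat.eqb_refl. }
unfold nodal. rewrite FL by (split; simpl; lra).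
rewrite <- Hflux in I.
eapply Rle_trans; [|apply Rplus_le_compat; [exact I|exact T]].
eapply Rle_trans; [|apply Rabs_triang].
apply Req_le, f_equal. unfold interface_defect, coefficient_defect. field. lra.
Qed.

Lemma truncation_right_of_interface (km ks K P : R) (f u : R -> R -> R)
    (GL GR : nat -> nat -> R -> R -> R) (M j : nat) :
  1 <= km -> 1 <= ks <= km -> (1 <= M)%nat ->
  interface_jets km K f u GL GR ->
  (forall y, 0 < y < 1 -> Rabs (GL 0%nat 2%nat (1 / 2) y) <= P) ->
  (forall y, 0 < y < 1 -> Rabs (GR 0%nat 2%nat (1 / 2) y) <= P) ->
  (1 <= j <= N M - 1)%nat ->
  Rabs (Lh km ks M (nodal M u) (M + 1) j
        - h M ^ 2 * f (node M (M + 1)) (node M j)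
        + ks * interface_defect km ks GL GR (h M) (node M j))
    <= 8 * km * K * h M ^ 3 + km * P * h M ^ 2.
Proof.
intros Hkm Hks HM [[HL HR] [EL [ER [FL [FR Hflux]]]]] HPL HPR Hj.
assert (Hh := h_bounds M HM). assert (E := node_M M).
assert (Jm := node_bounds M (j - 1) HM ltac:(lia)).
assert (J0 := node_bounds_strict M j HM Hj).
assert (Jp := node_bounds M (j + 1) HM ltac:(lia)).
specialize (Hflux (node M j) J0).
assert (T := tangential_term_bound km 1 ks _ _ P (h M) ltac:(lra) ltac:(lra)
  (HPR _ J0) (HPL _ J0)).
assert (I := truncation_at_interface (-1) 1 ks km (h M) K (1 / 2) 1 0 (1 / 2)
  (node M (j - 1)) (node M j) (node M (j + 1)) u GR GL
  (or_intror eq_refl) ltac:(lra) ltac:(lra) ltac:(lra) ltac:(lra) ltac:(lra)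
  HR HL ER EL ltac:(lra) ltac:(lra) ltac:(lra) ltac:(lra) ltac:(lra)
  ltac:(lra) ltac:(lra) ltac:(lra)).
specialize (I ltac:(rewrite node_pred by lia; lra) ltac:(rewrite node_S; lra)
  (node M (M + 1)) (node M (M + 1 + 1)) (node M M)
  ltac:(rewrite node_S; lra) ltac:(rewrite !node_S; lra) ltac:(lra)).
rewrite Lh_edge by lia.
replace (M + 1 - 1)%nat with M by lia.
replace (edge km ks M (M + 1)) with 1.
2:{ unfold edge. rewrite (proj2 (Nat.ltb_ge (M + 1) M)) by lia.
    now rewrite (proj2 (Nat.eqb_neq (M + 1) M)) by lia. }
replace (edge km ks M M) with ks.
2:{ unfold edge. now rewrite Nat.ltb_irrefl, Nat.eqb_refl. }
unfold nodal. rewrite FR by (split; simpl; try rewrite node_S; lra).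
rewrite <- Hflux in I.
eapply Rle_trans; [|apply Rplus_le_compat; [exact I|exact T]].
eapply Rle_trans; [|apply Rabs_triang].
apply Req_le, f_equal. unfold interface_defect, coefficient_defect. field. lra.
Qed.

Lemma scaled_defect_bound (d lam ks x B : R) :
  1 <= ks -> 0 <= d -> Rabs x <= B ->
  Rabs (d * (lam / ks) * x) <= d * Rabs lam * B.
Proof.
intros Hs Hd Hx.
rewrite Rabs_mult. apply Rmult_le_compat; try apply Rabs_pos; [|exact Hx].
rewrite Rabs_mult, (Rabs_pos_eq d) by exact Hd.
apply Rmult_le_compat_l; [exact Hd|].
unfold Rdiv. rewrite Rabs_mult, (Rabs_pos_eq (/ ks)).
2:{ apply Rlt_le, Rinv_0_lt_compat; lra. }
rewrite <- (Rmult_1_r (Rabs lam)) at 2.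
apply Rmult_le_compat_l; [apply Rabs_pos|].
rewrite <- Rinv_1. apply Rinv_le_contravar; lra.
Qed.

Lemma interface_defect_bound (km ks K d y : R) (f u : R -> R -> R)
    (GL GR : nat -> nat -> R -> R -> R) :
  1 <= ks -> 0 <= d -> interface_jets km K f u GL GR -> 0 <= y <= 1 ->
  Rabs (interface_defect km ks GL GR d y)
    <= K * (d ^ 2 + d * Rabs (coefficient_defect km ks)).
Proof.
intros Hs Hd [[[_ [BL _]] [_ [BR _]]] _] Hy.
assert (B1 := BL 1%nat 0%nat (1 / 2) y ltac:(lia) ltac:(split; simpl; lra)).
assert (B2 := BL 2%nat 0%nat (1 / 2) y ltac:(lia) ltac:(split; simpl; lra)).
assert (B3 := BR 2%nat 0%nat (1 / 2) y ltac:(lia) ltac:(split; simpl; lra)).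
assert (HK : 0 <= K) by (eapply Rle_trans; [apply Rabs_pos|exact B1]).
unfold interface_defect. set (lam := coefficient_defect km ks).
assert (T1 : Rabs (d * (lam / ks) * GL 1%nat 0%nat (1 / 2) y)
  <= d * Rabs lam * K).
{ now apply scaled_defect_bound. }
assert (T2 : Rabs (d ^ 2 / 8 * (GL 2%nat 0%nat (1 / 2) y - GR 2%nat 0%nat (1 / 2) y))
  <= d ^ 2 / 8 * (2 * K)).
{ apply Rabs_mult_le.
  - split; [|lra]. assert (Q := pow2_ge_0 d). lra.
  - apply Rabs_le_between in B2, B3. apply Rabs_le_between. lra. }
eapply Rle_trans; [apply Rabs_triang|].
assert (Q := pow2_ge_0 d). nra.
Qed.

Lemma interface_defect_second_difference (km ks K d y0 y1 y2 : R)
    (f u : R -> R -> R) (GL GR : nat -> nat -> R -> R -> R) :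
  1 <= ks -> 0 <= d -> interface_jets km K f u GL GR ->
  0 <= y0 <= 1 -> 0 <= y1 <= 1 -> 0 <= y2 <= 1 -> y1 - y0 = d -> y2 - y1 = d ->
  Rabs (interface_defect km ks GL GR d y0 + interface_defect km ks GL GR d y2
        - 2 * interface_defect km ks GL GR d y1)
    <= 2 * K * (d ^ 2 + d * Rabs (coefficient_defect km ks)) * d ^ 2.
Proof.
intros Hs Hd [[HL HR] _] H0 H1 H2 E1 E2.
assert (HK := jet_bound_nonneg 0 (1 / 2) K GL ltac:(lra) HL).
assert (SL : forall m, (m <= 2)%nat -> Rabs (GL m 0%nat (1 / 2) y0
  + GL m 0%nat (1 / 2) y2 - 2 * GL m 0%nat (1 / 2) y1) <= 2 * K * d ^ 2).
{ intros m Hm. rewrite <- E2. apply (jet_second_difference_y 0 (1 / 2)); trivial;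
    try lra; try lia; split; simpl; lra. }
assert (SR : Rabs (GR 2%nat 0%nat (1 / 2) y0
  + GR 2%nat 0%nat (1 / 2) y2 - 2 * GR 2%nat 0%nat (1 / 2) y1) <= 2 * K * d ^ 2).
{ rewrite <- E2. apply (jet_second_difference_y (1 / 2) 1); trivial;
    try lra; try lia; split; simpl; lra. }
assert (B1 := SL 1%nat ltac:(lia)). assert (B2 := SL 2%nat ltac:(lia)).
set (lam := coefficient_defect km ks).
set (D1 := GL 1%nat _ _ _ + _ - _) in B1.
set (D2 := GL 2%nat _ _ _ + _ - _) in B2.
set (D3 := GR 2%nat _ _ _ + _ - _) in SR.
replace (interface_defect km ks GL GR d y0 + interface_defect km ks GL GR d y2
        - 2 * interface_defect km ks GL GR d y1)
  with (d * (lam / ks) * D1 + d ^ 2 / 8 * (D2 - D3)).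
2:{ unfold interface_defect, D1, D2, D3. fold lam. field. lra. }
assert (T1 : Rabs (d * (lam / ks) * D1) <= d * Rabs lam * (2 * K * d ^ 2)).
{ now apply scaled_defect_bound. }
assert (Q := pow2_ge_0 d).
assert (Q4 : 0 <= K * d ^ 2) by (now apply Rmult_le_pos).
assert (T2 : Rabs (d ^ 2 / 8 * (D2 - D3)) <= d ^ 2 / 8 * (4 * K * d ^ 2)).
{ apply Rabs_mult_le; [lra|].
  apply Rabs_le_between in B2, SR. apply Rabs_le_between. lra. }
eapply Rle_trans; [apply Rabs_triang|]. nra.
Qed.

(** The common source of both estimates: in the first one [P] is the bound on the
    second derivatives, in the second one [P] and [coefficient_defect]
    vanish. *)
Lemma nodal_error_bound (km ks K P : R) (f u : R -> R -> R)
    (GL GR : nat -> nat -> R -> R -> R) (M : nat) (v : nat -> nat -> R) :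
  1 <= km -> 1 <= ks <= km -> 0 <= P -> (1 <= M)%nat ->
  interface_jets km K f u GL GR ->
  (forall y, 0 < y < 1 -> Rabs (GL 0%nat 2%nat (1 / 2) y) <= P) ->
  (forall y, 0 < y < 1 -> Rabs (GR 0%nat 2%nat (1 / 2) y) <= P) ->
  (forall x y, boundary_Omega (x, y) -> u x y = 0) ->
  discrete_solution km ks f M v ->
  forall i j, (i <= N M)%nat -> (j <= N M)%nat ->
  Rabs (error M u v i j)
    <= (3 * (km + 2) + 1) * ((8 * km * K + km)
         * (h M ^ 2 + h M * (Rabs (coefficient_defect km ks) + P))).
Proof.
intros Hkm Hks HP HM HJ HPL HPR Hu0 Hv.
assert (Hh := h_bounds M HM).
assert (HJ' := HJ). destruct HJ' as [[HL HR] [EL [ER [FL [FR _]]]]].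
assert (HK := jet_bound_nonneg 0 (1 / 2) K GL ltac:(lra) HL).
set (lam := Rabs (coefficient_defect km ks)).
assert (Hlam : 0 <= lam) by apply Rabs_pos.
set (r := h M ^ 2 + h M * (lam + P)).
set (A := 8 * km * K + km).
assert (HkK : 0 <= km * K) by (apply Rmult_le_pos; lra).
assert (HKk : K <= km * K) by nra.
assert (HA : 0 <= A) by (unfold A; lra).
assert (Hh2 : 0 <= h M ^ 2) by apply pow2_ge_0.
assert (HhP : 0 <= h M * P) by (apply Rmult_le_pos; lra).
assert (Hhl : 0 <= h M * lam) by (apply Rmult_le_pos; lra).
assert (Hr : 0 <= r) by (unfold r; nra).
assert (Hr2 : h M ^ 2 <= r) by (unfold r; nra).
assert (HrP : h M * P <= r) by (unfold r; nra).
assert (Hrl : h M ^ 2 + h M * lam <= r) by (unfold r; nra).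
assert (HKA : forall c t, 0 <= c <= A -> 0 <= t <= r -> c * t <= A * r).
{ intros c t Hc Ht. apply Rmult_le_compat; lra. }
assert (Hint : 6 * km * K * h M ^ 4 <= A * r * h M ^ 2).
{ replace (6 * km * K * h M ^ 4) with (6 * km * K * h M ^ 2 * h M ^ 2) by ring.
  apply Rmult_le_compat_r; [exact Hh2|]. apply HKA; unfold A; lra. }
assert (Hinf : 8 * km * K * h M ^ 3 + km * P * h M ^ 2 <= A * r * h M).
{ replace (8 * km * K * h M ^ 3 + km * P * h M ^ 2)
    with ((8 * km * K * h M ^ 2 + km * (h M * P)) * h M) by ring.
  apply Rmult_le_compat_r; [lra|]. unfold A. rewrite Rmult_plus_distr_r.
  apply Rplus_le_compat; apply Rmult_le_compat_l; lra. }
apply (corrected_convergence km ks A r M f (nodal M u) v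
  (fun j => interface_defect km ks GL GR (h M) (node M j))); trivial.
- intros i j Hi Hj Hb. apply Hu0.
  assert (Bi := node_bounds M i HM Hi). assert (Bj := node_bounds M j HM Hj).
  split; [split; assumption|]. intros [Hx Hy]. simpl in Hx, Hy.
  destruct Hb as [-> | [-> | [-> | ->]]];
    rewrite ?node_0, ?node_N in *; lra.
- intros j Hj.
  eapply Rle_trans; [apply (interface_defect_bound km ks K (h M) _ f u); trivial;
    try lra; now apply node_bounds|].
  fold lam. apply HKA; [unfold A; lra|lra].
- intros j Hj.
  eapply Rle_trans; [apply (interface_defect_second_difference km ks K (h M) _ _ _ f u);
    trivial; try lra; try (apply node_bounds; trivial; lia);
    rewrite ?node_S, ?node_pred by lia; lra|].
  fold lam. apply Rmult_le_compat_r; [exact Hh2|].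
  apply HKA; [unfold A; lra|lra].
- intros i j Hi Hj N1 N2.
  eapply Rle_trans; [|exact Hint].
  assert (E := node_M M).
  assert (Bj := node_bounds_strict M j HM Hj).
  destruct (Nat.lt_ge_cases i M) as [L|L].
  + assert (B1 := node_bounds M (i - 1) HM ltac:(lia)).
    assert (B2 := node_le M (i + 1) M HM ltac:(lia)).
    assert (B3 := node_le M i M HM ltac:(lia)).
    assert (B4 := node_bounds_strict M i HM Hi).
    apply (truncation_inside_subdomain 0 (1 / 2) km km ks K f u GL);
      trivial; try lra; try lia.
    * apply FL. split; simpl; lra.
    * unfold edge. now rewrite (proj2 (Nat.ltb_lt (i - 1) M)) by lia.
    * unfold edge. now rewrite (proj2 (Nat.ltb_lt i M)) by lia.
  + assert (B1 := node_bounds M (i + 1) HM ltac:(lia)).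
    assert (B2 := node_le M (M + 1) (i - 1) HM ltac:(lia)).
    assert (B3 := node_le M (M + 1) i HM ltac:(lia)).
    rewrite node_S in B2, B3.
    assert (B4 := node_bounds_strict M i HM Hi).
    apply (truncation_inside_subdomain (1 / 2) 1 1 km ks K f u GR);
      trivial; try lra; try lia.
    * apply FR. split; simpl; lra.
    * unfold edge. rewrite (proj2 (Nat.ltb_ge (i - 1) M)) by lia.
      now rewrite (proj2 (Nat.eqb_neq (i - 1) M)) by lia.
    * unfold edge. rewrite (proj2 (Nat.ltb_ge i M)) by lia.
      now rewrite (proj2 (Nat.eqb_neq i M)) by lia.
- intros j Hj. eapply Rle_trans; [|exact Hinf].
  now apply truncation_left_of_interface.
- intros j Hj. eapply Rle_trans; [|exact Hinf].
  now apply truncation_right_of_interface.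
Qed.

Lemma max_norm_le (M : nat) (e : nat -> nat -> R) (B : R) :
  0 <= B ->
  (forall i j, (i <= N M)%nat -> (j <= N M)%nat -> Rabs (e i j) <= B) ->
  max_norm M e <= B.
Proof.
intros HB He. unfold max_norm.
assert (H : forall p, In p (list_prod (seq 0 (S (N M))) (seq 0 (S (N M)))) ->
  Rabs (e (fst p) (snd p)) <= B).
{ intros [i j] Hp. apply in_prod_iff in Hp. destruct Hp as [Hi Hj].
  apply in_seq in Hi, Hj. apply (He i j); lia. }
revert H. induction (list_prod _ _) as [|p l IH]; intros H; simpl; [exact HB|].
apply Rmax_lub; [apply H; now left|]. apply IH. intros q Hq. apply H. now right.
Qed.

(** [h <= 1 / 3 <= exp (-1)]. *)
Lemma abs_ln_h_ge_1 (M : nat) : (1 <= M)%nat -> 1 <= Rabs (ln (h M)).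
Proof.
intros HM. assert (Hh := h_bounds M HM).
assert (L : ln (h M) <= - (1)).
{ rewrite <- (ln_exp (- (1))). apply ln_le; [lra|].
  rewrite exp_Ropp. eapply Rle_trans; [apply Hh|].
  unfold Rdiv. rewrite Rmult_1_l.
  apply Rinv_le_contravar; [apply exp_pos|apply exp_le_3]. }
rewrite Rabs_left by lra. lra.
Qed.

Theorem theorem4p4 :
  forall (km ks : R) (f u : R -> R -> R),
    1 <= km -> 1 <= ks <= km ->
    exact_solution km f u ->
    in_W u ->
    (exists C : R, 0 < C /\
       forall (M : nat) (v : nat -> nat -> R),
         (1 <= M)%nat ->
         discrete_solution km ks f M v ->
         max_norm M (error M u v) <= C * (h M * Rabs (ln (h M)))) /\
    (assumption_I km ks u ->
     exists C : R, 0 < C /\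
       forall (M : nat) (v : nat -> nat -> R),
         (1 <= M)%nat ->
         discrete_solution km ks f M v ->
         max_norm M (error M u v) <= C * (h M ^ 2 * Rabs (ln (h M)))).
Proof.
intros km ks f u Hkm Hks Hex [HWL HWR].
destruct (closed_jet_of_Ck _ _ _ HWL) as [GL [KL [HL [EL DL]]]].
destruct (closed_jet_of_Ck _ _ _ HWR) as [GR [KR [HR [ER DR]]]].
set (K := Rmax KL KR).
apply (closed_jet_weaken _ _ _ K) in HL; [|apply Rmax_l].
apply (closed_jet_weaken _ _ _ K) in HR; [|apply Rmax_r].
assert (HJ : interface_jets km K f u GL GR).
{ split; [now split|]. split; [exact EL|]. split; [exact ER|].
  split; [|split].
  - intros x y Hxy. rewrite !DL by (trivial; lia). now apply exact_solution_left.
  - intros x y Hxy. rewrite !DR by (trivial; lia). now apply (exact_solution_right km).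
  - intros y Hy. apply (flux_continuity km K f u); trivial.
    + intros x z Hxz. apply DL; [lia|exact Hxz].
    + intros x z Hxz. apply DR; [lia|exact Hxz]. }
assert (HK := jet_bound_nonneg 0 (1 / 2) K GL ltac:(lra) HL).
assert (Hu0 : forall x y, boundary_Omega (x, y) -> u x y = 0) by apply Hex.
assert (HkK : 0 <= km * K) by (apply Rmult_le_pos; lra).
set (A := (3 * (km + 2) + 1) * (8 * km * K + km)).
assert (HA : 0 < A) by (unfold A; apply Rmult_lt_0_compat; lra).
split.
- set (c := Rabs (coefficient_defect km ks) + K).
  assert (Hc : 0 <= c)
    by (unfold c; assert (Q := Rabs_pos (coefficient_defect km ks)); lra).
  exists (A * (1 + c)). split; [apply Rmult_lt_0_compat; lra|].
  intros M v HM Hv. assert (Hh := h_bounds M HM).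
  assert (Hln := abs_ln_h_ge_1 M HM).
  assert (Hhl : h M <= h M * Rabs (ln (h M))) by nra.
  assert (S1 : h M ^ 2 + h M * c <= (1 + c) * (h M * Rabs (ln (h M)))) by nra.
  apply max_norm_le.
  + apply Rmult_le_pos; [apply Rmult_le_pos; lra|lra].
  + intros i j Hi Hj.
    eapply Rle_trans;
      [apply (nodal_error_bound km ks K K f u GL GR); trivial|].
    * intros y Hy. apply HL; [lia|split; simpl; lra].
    * intros y Hy. apply HR; [lia|split; simpl; lra].
    * fold c. rewrite <- Rmult_assoc. fold A. rewrite (Rmult_assoc A).
      apply Rmult_le_compat_l; [lra|exact S1].
- intros [Eks Htan].
  assert (Hdef : coefficient_defect km ks = 0).
  { unfold coefficient_defect. rewrite Eks. field. lra. }
  exists A. split; [exact HA|].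
  intros M v HM Hv. assert (Hh := h_bounds M HM).
  assert (Hln := abs_ln_h_ge_1 M HM).
  assert (Hh2 := pow2_ge_0 (h M)).
  assert (Hhl : h M ^ 2 <= h M ^ 2 * Rabs (ln (h M))) by nra.
  apply max_norm_le.
  + apply Rmult_le_pos; lra.
  + intros i j Hi Hj.
    eapply Rle_trans;
      [apply (nodal_error_bound km ks K 0 f u GL GR); trivial; try lra|].
    * intros y Hy. apply Req_le.
      replace (GL 0%nat 2%nat (1 / 2) y) with 0; [apply Rabs_R0|].
      apply (filterlim_locally_unique (F := at_left (1 / 2))
        (fun x => partial_derive 0 2 u x y)); [now apply Htan|].
      apply (filterlim_ext_loc (fun x => GL 0%nat 2%nat x y)).
      -- apply near_left. intros x Hx. apply DL; [lia|split; assumption].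
      -- apply trace_left; [|exact Hy]. apply HL. lia.
    * intros y Hy. apply Req_le.
      replace (GR 0%nat 2%nat (1 / 2) y) with 0; [apply Rabs_R0|].
      apply (filterlim_locally_unique (F := at_right (1 / 2))
        (fun x => partial_derive 0 2 u x y)); [now apply Htan|].
      apply (filterlim_ext_loc (fun x => GR 0%nat 2%nat x y)).
      -- apply near_right. intros x Hx. apply DR; [lia|split; assumption].
      -- apply trace_right; [|exact Hy]. apply HR. lia.
    * rewrite Hdef, Rabs_R0, Rplus_0_r, Rmult_0_r, Rplus_0_r.
      rewrite <- Rmult_assoc. fold A. apply Rmult_le_compat_l; lra.
Qed.
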